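(* Let $n\ge1$, let $\mathscr{U}_{\{n\}}=\{U\in U(n)\mid\dim\ker(1-U)=n-1\}$, a submanifold of the unitary group $U(n)$, and let $$c_{n-1/2}=-\left(\frac{i}{2\pi}\right)^n\frac{[(n-1)!]^2}{(2n-1)!}\operatorname{tr}\wedge^{2n-1}g^{-1}dg\in\Omega^{2n-1}(U(n)).$$ Then $$\int_{\mathscr{U}_{\{n\}}}c_{n-1/2}=1.$$
   Context: $g^{-1}dg$ is the Maurer-Cartan form of $U(n)$ and $\wedge^{2n-1}g^{-1}dg$ is its $(2n-1)$-fold product (wedge product of forms combined with matrix multiplication). Orientation of $\mathscr{U}_{\{n\}}$: let $\mathbb{CP}^{n-1}$ be the space of complex lines in $\mathbb{C}^n$ and $\phi:S^1\times\mathbb{CP}^{n-1}\to U(n)$, $\phi(\lambda,L)=\lambda\,\mathrm{id}_L\oplus\mathrm{id}_{L^\perp}$. The restriction of $\phi$ to $(S^1\setminus\{1\})\times\mathbb{CP}^{n-1}$ is a diffeomorphism onto $\mathscr{U}_{\{n\}}$, and it is declared to be orientation preserving, where $S^1$ is oriented counterclockwise, $\mathbb{CP}^{n-1}$ has its complex orientation and $S^1\times\mathbb{CP}^{n-1}$ the product orientation. *)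

(* Defs.v *)
From HB Require Import structures.
From mathcomp Require Import all_boot all_order all_algebra all_fingroup.
From mathcomp Require Import complex.
From mathcomp Require Import all_classical all_reals all_analysis.

Set Implicit Arguments.
Unset Strict Implicit.
Unset Printing Implicit Defensive.

Import Order.TTheory GRing.Theory Num.Theory.
Import numFieldNormedType.Exports.

Local Open Scope classical_set_scope.
Local Open Scope ring_scope.

Section LebesgueTuple.
Variable R : realType.

Definition consp d (p : measurableTypeR R * d.-tuple (measurableTypeR R)) :
  d.+1.-tuple (measurableTypeR R) := [tuple of p.1 :: p.2].

Lemma measurable_consp d : measurable_fun setT (@consp d).
Proof. exact: measurable_cons. Qed.

Lemma measurable_unconsp d : measurable_fun setT
  (fun t : d.+1.-tuple (measurableTypeR R) => (thead t, [tuple of behead t])).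
Proof.
apply: measurable_fun_pair; first exact: measurable_tnth.
exact: measurable_behead.
Qed.

Variables (d : nat)
  (mu : {sigma_finite_measure set (d.-tuple (measurableTypeR R)) -> \bar R}).

Definition lebesgue_cons : set (d.+1.-tuple (measurableTypeR R)) -> \bar R :=
  pushforward (@lebesgue_measure R \x mu)%E (@consp d).

HB.instance Definition _ := Measure.copy lebesgue_cons
  (measure_function_pushforward__canonical__measure_function_Measure
     (@lebesgue_measure R \x mu)%E (@measurable_consp d)).

Lemma lebesgue_cons_sigma_finite : sigma_finite setT lebesgue_cons.
Proof.
have /sigma_finiteP[F [FT ndF Foo]] := sigma_finiteT (@lebesgue_measure R).
have /sigma_finiteP[G [GT ndG Goo]] := sigma_finiteT mu.
pose u (t : d.+1.-tuple (measurableTypeR R)) := (thead t, [tuple of behead t]).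
exists (fun i => u @^-1` (F i `*` G i)).
  apply/seteqP; split=> // t _ /=.
  have [i _ Fi] : (\bigcup_i F i) (u t).1 by rewrite -FT.
  have [j _ Gj] : (\bigcup_i G i) (u t).2 by rewrite -GT.
  exists (maxn i j) => //; split.
    by move: Fi; exact/subsetPset/ndF/leq_maxl.
  by move: Gj; exact/subsetPset/ndG/leq_maxr.
move=> i; have [mF Flt] := Foo i; have [mG Glt] := Goo i; split.
  by rewrite -[X in measurable X]setTI; apply: measurable_unconsp => //;
    exact: measurableX.
rewrite /lebesgue_cons /pushforward (_ : _ @^-1` _ = F i `*` G i).
  by rewrite product_measure1E// lte_mul_pinfty// ge0_fin_numE.
have uK x t : u (@consp d (x, t)) = (x, t).
  by rewrite /u /consp theadE; congr pair; exact: val_inj.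
by apply/seteqP; split=> -[x t]; rewrite /preimage /mkset uK.
Qed.

HB.instance Definition _ := Measure_isSigmaFinite.Build _ _ _ lebesgue_cons
  lebesgue_cons_sigma_finite.

End LebesgueTuple.

(* Lebesgue measure on R^d with its Borel (product) sigma-algebra: the product
   of [lebesgue_measure] with the [d-1]-dimensional one, transported along the
   identification of R x R^(d-1) with R^d. *)
Fixpoint lebesgue_tuple (R : realType) d :
    {sigma_finite_measure set (d.-tuple (measurableTypeR R)) -> \bar R} :=
  if d is d'.+1 then lebesgue_cons (lebesgue_tuple R d')
  else \d_([tuple] : 0.-tuple (measurableTypeR R)).

Section FormIntegral.
Variable R : realType.
Local Notation C := R[i].

(* Measurability and [lebesgue_tuple] live on [d]-tuples, topology and
   derivatives on row vectors. *)
Definition row_of_tuple d (t : d.-tuple (measurableTypeR R)) : 'rV[R]_d :=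
  \row_i tnth t i.

(* The value at [g] of a complex-valued [d]-form on the space of matrices is a
   function of [d] tangent vectors, a tangent vector being itself a matrix. *)
Definition form n d := 'M[C]_n -> ('I_d -> 'M[C]_n) -> C.

Definition partial d n (f : 'rV[R]_d -> 'M[C]_n) (t : 'rV[R]_d) (j : 'I_d) :
    'M[C]_n :=
  \matrix_(a, b) Complex
    ('D_(delta_mx 0 j) (fun s => complex.Re (f s a b)) t)
    ('D_(delta_mx 0 j) (fun s => complex.Im (f s a b)) t).

Definition C1_real d (W : set 'rV[R]_d) (u : 'rV[R]_d -> R) : Prop :=
  forall (j : 'I_d) t, W t ->
    derivable u t (delta_mx 0 j) /\
    {for t, continuous ('D_(delta_mx 0 j) u)}.

Definition C1 d n (W : set 'rV[R]_d) (f : 'rV[R]_d -> 'M[C]_n) : Prop :=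
  forall a b, C1_real W (fun s => complex.Re (f s a b)) /\
              C1_real W (fun s => complex.Im (f s a b)).

(* An orientation of a [d]-dimensional submanifold is given by its predicate
   [pos]: [pos p X] says that [X] is a positively oriented basis of the tangent
   space at [p].  In [positive_param], the differential of [f] is then
   invertible onto the tangent space, so that [f], being injective, is a
   diffeomorphism of [W] onto an open subset of [M] by the inverse function
   theorem. *)
Definition positive_param d n (M : set 'M[C]_n)
    (pos : 'M[C]_n -> ('I_d -> 'M[C]_n) -> Prop)
    (W : set 'rV[R]_d) (f : 'rV[R]_d -> 'M[C]_n) : Prop :=
  [/\ open W, C1 W f, {in W &, injective f}, f @` W `<=` M &
      forall t, W t -> pos (f t) (partial f t)].

Definition pullback d n (f : 'rV[R]_d -> 'M[C]_n) (w : form n d)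
    (t : d.-tuple (measurableTypeR R)) : C :=
  w (f (row_of_tuple t)) (partial f (row_of_tuple t)).

(* [has_form_integral M pos w v]: the form [w] is absolutely integrable over
   the oriented embedded submanifold [M] and its integral is [v].  [M] is cut
   into the disjoint images of Borel sets [A k] under finitely many positively
   oriented parametrizations [f k]; by the change of variables formula (for
   which C^1 is enough) the resulting sum does not depend on these choices. *)
Definition has_form_integral d n (M : set 'M[C]_n)
    (pos : 'M[C]_n -> ('I_d -> 'M[C]_n) -> Prop) (w : form n d) (v : C) :
    Prop :=
  exists (N : nat) (W : 'I_N -> set 'rV[R]_d)
    (f : 'I_N -> 'rV[R]_d -> 'M[C]_n)
    (A : 'I_N -> set (d.-tuple (measurableTypeR R))),
    let piece k := f k @` (@row_of_tuple d @` A k) in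
    [/\ (forall k, positive_param M pos (W k) (f k)),
        (forall k, measurable (A k) /\ @row_of_tuple d @` A k `<=` W k),
        \bigcup_k piece k = M /\ trivIset setT piece,
        (forall k,
          (lebesgue_tuple R d).-integrable (A k)
            (fun t => (complex.Re (pullback (f k) w t))%:E) /\
          (lebesgue_tuple R d).-integrable (A k)
            (fun t => (complex.Im (pullback (f k) w t))%:E)) &
        v = \sum_(k < N) Complex
          (\int[lebesgue_tuple R d]_(t in A k) complex.Re (pullback (f k) w t))
          (\int[lebesgue_tuple R d]_(t in A k) complex.Im (pullback (f k) w t))].

End FormIntegral.

Section Stratum.
Local Open Scope sesquilinear_scope.
Variables (R : realType) (n : nat).
Local Notation C := R[i].
Local Notation dim := (2 * n).-1%N.

(* [kermx] is the kernel of the action on row vectors, whence the transpose. *)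
Definition stratum : set 'M[C]_n :=
  [set U | U \is unitarymx /\ \rank (kermx (1%:M - U)^T) = n.-1].

Definition maurer_cartan (g X : 'M[C]_n) : 'M[C]_n := invmx g *m X.

(* The wedge product is normalized by
   (dx_1 /\ ... /\ dx_d) (e_1, ..., e_d) = 1, i.e. without a factor 1 / d!. *)
Definition wedge_power d (a : 'M[C]_n -> 'M[C]_n -> 'M[C]_n)
    (g : 'M[C]_n) (X : 'I_d -> 'M[C]_n) : 'M[C]_n :=
  \sum_(s : 'S_d) (-1) ^+ s *: \big[mulmx/1%:M]_(i < d) a g (X (s i)).

Definition c_form : form R n dim := fun g X =>
  - ('i / (2 * pi)%:C)%C ^+ n
  * ((n.-1)`! ^ 2)%N%:R / ((2 * n).-1)`!%N%:R
  * \tr (wedge_power maurer_cartan g X).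

(* lambda id_L (+) id_{L^perp} for the line L spanned by [v]; [P] is the
   orthogonal projection onto L. *)
Definition phi (lambda : C) (v : 'cV[C]_n) : 'M[C]_n :=
  let P := ((v ^t* *m v) 0 0)^-1 *: (v *m v ^t*) in
  lambda *: P + (1%:M - P).

Definition coord d (t : 'rV[R]_d) (j : nat) : R :=
  if insub j is Some i then t 0 i else 0.

(* The point of C^n with [k]-th coordinate 1 and remaining coordinates
   z_0, ..., z_(n-2) in this order. *)
Definition affine_point (k : 'I_n) (z : nat -> C) : 'cV[C]_n :=
  \col_i (if i == k then 1 else z (unbump k i)).

(* phi in the coordinates (theta, x_0, y_0, ..., x_(n-2), y_(n-2)) of
   S^1 x CP^(n-1), with lambda = exp (i theta) and z_j = x_j + i y_j in the
   [k]-th affine chart of CP^(n-1). *)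
Definition phi_param (k : 'I_n) (t : 'rV[R]_dim) : 'M[C]_n :=
  phi (Complex (cos (coord t 0)) (sin (coord t 0)))
    (affine_point k (fun j => Complex (coord t j.*2.+1) (coord t j.*2.+2))).

(* Holomorphic charts, with real coordinates ordered as x_0, y_0, x_1, ...,
   define the complex orientation, and theta increases counterclockwise:
   declaring phi orientation preserving means that the frames of partial
   derivatives of the [phi_param k] are positive. *)
Definition stratum_pos (p : 'M[C]_n) (X : 'I_dim -> 'M[C]_n) : Prop :=
  exists (k : 'I_n) (t : 'rV[R]_dim) (A : 'M[R]_dim),
    [/\ 0 < coord t 0 < 2 * pi, phi_param k t = p, 0 < \det A &
        forall i, X i = \sum_j (A i j)%:C%C *: partial (phi_param k) t j].

End Stratum.

(* Main.v *)
From mathcomp Require Import all_boot all_order all_algebra all_fingroup.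
From mathcomp Require Import complex ring lra.
From mathcomp Require Import all_classical all_reals all_analysis.
From mathcomp Require Import measurable_realfun.
Require Import Defs.

Set Implicit Arguments.
Unset Strict Implicit.
Unset Printing Implicit Defensive.

Import Order.TTheory GRing.Theory Num.Theory.
Import numFieldNormedType.Exports.

Local Open Scope classical_set_scope.
Local Open Scope ring_scope.

(* With c = v^* v and P = v v^* / c, the map phi (l, v) = 1 + (l - 1) P is
   pulled back in an affine chart of CP^(n-1), N = n - 1.  For a tangent vector
   w and its part u orthogonal to v,
     g^-1 d_theta g = i P,
     g^-1 d_w g = ((l - 1) / c) u v^* + ((1 - l^-1) / c) v u^*.
   The trace being cyclic and 2 N + 1 odd, the wedge power is 2 N + 1 times the
   sum over the permutations that put d_theta first; the products of rank one
   matrices then contract to the products of the numbers u_p^* u_q over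
   consecutive pairs (p, q).  Expanding these numbers in the coordinates dz_j
   turns the alternating sum into N! times a determinant, computed from
   det (1 - z z^* / c) = 1 / c.  In every chart the form is therefore
     K (2 - 2 cos theta)^N (1 + |z|^2)^-(N + 1) dtheta dx dy,
   K = 2^N N!^3 / ((2 pi)^(N + 1) (2 N)!).
   Its integral is computed by Tonelli, with
     int_0^2pi (2 - 2 cos theta)^N dtheta = 2 pi (2 N)! / N!^2 and
     int (1 + |z|^2)^-(N + 1) = pi^N / N!.
   The stratum is cut according to the first nonzero coordinate of the line; all
   pieces but that of the chart 0 are null. *)

(** * Alternating sums of products of rank one matrices *)

(** [has_form_integral] asks for an exact partition of the stratum, so the null pieces cannot be
    dropped: they too need injective positive charts, and the density is computed in every chart
    although a single cell has positive measure.

    The algebra is kept apart from complex conjugation: the row [v'] standing for the adjoint of [v]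
    is an independent variable and the imaginary unit is an arbitrary ring element, until the signs
    are collected. There i^(N + 1) comes from the constant of the form, i from d_theta, (2 i)^N from
    the products of conj(dz_j) with dz_j, each equal to 2 i dx_j dy_j, and (-1)^N from (l - 1) (1 -
    l^-1) = - |l - 1|^2. With the leading minus sign these factors multiply to 2^N, and this
    positivity is where the chosen orientation agrees with the form. *)

Section AlternatingSums.
Variable R : comNzRingType.

(** Left multiplication by this matrix puts row [J k] in place of row [k], which turns a choice of
    summation indices into a matrix product. *)
Definition selection_mx N (J : {ffun 'I_N -> 'I_N}) : 'M[R]_N :=
  \matrix_(k, l) (J k == l)%:R.

(** A non-injective [J] repeats a row and contributes 0; a permutation contributes the square of its
    sign. *)
Lemma sum_det_selection_mx_sqr N :
  \sum_(J : {ffun 'I_N -> 'I_N}) \det (selection_mx J) ^+ 2 = N`!%:R.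
Proof.
rewrite (bigID (fun J : {ffun 'I_N -> 'I_N} => injectiveb J)) /= addrC.
rewrite big1 ?add0r => [|J /injectivePn[k [l kl Jkl]]]; last first.
  rewrite (_ : \det _ = 0) ?expr0n//; apply: (determinant_alternate kl) => j.
  by rewrite !mxE Jkl.
rewrite (reindex (@pval _)) /=; last first.
  pose in_Sn := insubd (1%g : 'S_N).
  by exists in_Sn => /= f Uf; first apply: val_inj; apply: insubdK.
rewrite (eq_big xpredT (fun=> 1)) => [||s _].
- by rewrite sumr_const card_Sn.
- by move=> s; exact: (valP s).
rewrite (_ : selection_mx _ = perm_mx s) ?det_perm ?sqrr_sign//.
by apply/matrixP => i j; rewrite !mxE pvalE.
Qed.

(* The pairs of positions are [(1 + k, 1 + N + k)]. *)
Lemma sum_sign_prod_pairs_block N (e : 'rV[R]_(1 + (N + N)))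
    (x y : 'M[R]_(N, 1 + (N + N))) :
  \sum_(s : 'S_(1 + (N + N))) (-1) ^+ s *
    (e 0 (s (lshift _ 0)) *
     \prod_(k < N) \sum_(j < N)
       x j (s (rshift 1 (lshift N k))) * y j (s (rshift 1 (rshift N k)))) =
  N`!%:R * \det (col_mx e (col_mx x y)).
Proof.
(* Distributing the product over the inner sums assigns to each pair [k] an index [J k], used in
   both [x] and [y]. The selection matrix therefore occurs twice, and the sign of [J] disappears. *)
pose B (J : {ffun 'I_N -> 'I_N}) : 'M[R]_(1 + (N + N)) :=
  block_mx 1%:M 0 0 (block_mx (selection_mx J) 0 0 (selection_mx J)).
transitivity (\sum_(J : {ffun 'I_N -> 'I_N})
    \det (B J *m col_mx e (col_mx x y))); last first.
  rewrite -sum_det_selection_mx_sqr mulr_suml; apply: eq_bigr => J _.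
  by rewrite det_mulmx /B !det_ublock det1 mul1r -expr2.
rewrite [RHS]exchange_big /=; apply: eq_bigr => s _.
rewrite -mulr_sumr; congr (_ * _).
rewrite bigA_distr_bigA mulr_sumr /=; apply: eq_bigr => J _.
have selE (z : 'M[R]_(N, 1 + (N + N))) k c :
    (selection_mx J *m z) k c = z (J k) c.
  rewrite !mxE (bigD1 (J k)) //= big1 ?addr0 => [|l Jkl]; rewrite !mxE.
    by rewrite eqxx mul1r.
  by rewrite eq_sym (negbTE Jkl) mul0r.
rewrite !mul_block_col !mul0mx !addr0 !add0r mul1mx.
rewrite !big_split_ord /= big_ord1 !col_mxEu; congr (_ * _).
rewrite -big_split /=; apply: eq_bigr => k _.
by rewrite !col_mxEd col_mxEu !selE.
Qed.

(** Conjugating [s] by the relabelling [p] preserves its sign, and the columns of the determinant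
    are relabelled along with it, so the sign of [p] never enters. *)
Lemma sum_sign_prod_pairs d N (p : 'I_(1 + (N + N)) -> 'I_d)
    (e : 'I_d -> R) (x y : 'I_N -> 'I_d -> R) :
  d = (1 + (N + N))%N -> injective p ->
  \sum_(s : 'S_d) (-1) ^+ s *
    (e (s (p (lshift _ 0))) *
     \prod_(k < N) \sum_(j < N)
       x j (s (p (rshift 1 (lshift N k)))) *
       y j (s (p (rshift 1 (rshift N k))))) =
  N`!%:R * \det (col_mx (\row_c e (p c))
    (col_mx (\matrix_(j, c) x j (p c)) (\matrix_(j, c) y j (p c)))).
Proof.
move=> dE; subst d => p_inj; rewrite -sum_sign_prod_pairs_block.
pose q := perm p_inj.
have conj_bij : bijective (fun s => q^-1 * s * q)%g.
  exists (fun s => q * s * q^-1)%g => s; rewrite !mulgA.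
    by rewrite mulgV mul1g mulgK.
  by rewrite mulVg mul1g mulgKV.
rewrite (reindex _ (onW_bij _ conj_bij)) /=; apply: eq_bigr => s _.
have sE c : (q^-1 * s * q)%g (p c) = p (s c).
  by rewrite !permM -[p c](permE p_inj) permK permE.
rewrite !odd_permM odd_permV addbAC addbb addFb; congr (_ * _).
rewrite sE mxE; congr (_ * _); apply: eq_bigr => k _; apply: eq_bigr => j _.
by rewrite !sE !mxE.
Qed.

(* The cyclic shift of an odd number of positions is an even permutation, so
   each position of the index [i0] contributes the same amount. *)
Lemma sum_sign_mxtrace_prod_cyclic n d (w : 'I_d -> 'M[R]_n.+1) (i0 : 'I_d) :
  odd d ->
  \sum_(s : 'S_d) (-1) ^+ s * \tr (\prod_(i < d) w (s i)) =
  d%:R * \sum_(s : 'S_d | s i0 == i0) (-1) ^+ s * \tr (\prod_(i < d) w (s i)).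
Proof.
case: d w i0 => [|d] w i0 // d_odd.
pose t s := (-1) ^+ odd_perm s * \tr (\prod_(i < d.+1) w (s i)).
have ordS_inj : injective (@ordS d.+1) by apply: (can_inj (@ordSK d.+1)).
pose c : 'S_d.+1 := perm ordS_inj.
have iter_c k (i : 'I_d.+1) : (c ^+ k)%g i = ((i + k) %% d.+1)%N :> nat.
  rewrite permX; elim: k => [|k IHk]; first by rewrite addn0 modn_small.
  by rewrite iterS permE /= IHk addnS -addn1 modnDml addn1.
(* The order of [c] divides the odd number [d.+1]. *)
have c_even : odd_perm c = false.
  have cd1 : (c ^+ d.+1)%g = 1%g.
    apply/permP => i; rewrite perm1; apply: val_inj.
    by rewrite /= iter_c modnDr modn_small.
  have := congr1 (@odd_perm _) cd1; rewrite odd_perm1 /=.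
  suff -> k : odd_perm (c ^+ k)%g = odd k && odd_perm c by rewrite d_odd.
  elim: k => [|k IHk]; first by rewrite expg0 odd_perm1.
  by rewrite expgS odd_permM IHk /=; case: (odd_perm c); case: (odd k).
have tc s : t (c * s)%g = t s.
  rewrite /t odd_permM c_even addFb; congr (_ * _).
  rewrite big_ord_recr [in RHS]big_ord_recl /= [RHS]mxtrace_mulC; congr (\tr _).
  congr (_ * _).
    apply: eq_bigr => i _; rewrite permM permE; congr (w (s _)).
    by apply: val_inj; rewrite /= modn_small // ltnS.
  by rewrite permM permE; congr (w (s _)); apply: val_inj; rewrite /= modnn.
have tcX k s : t (c ^+ k * s)%g = t s.
  by elim: k => [|k IHk]; rewrite ?mul1g // expgS -mulgA tc.
(* Permutations are grouped by the position [j] at which [i0] occurs; the power of [c] sending [i0]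
   to [j] carries the group of [j] to that of [i0]. *)
have inner (j : 'I_d.+1) :
    \sum_(s : 'S_d.+1 | s j == i0) t s = \sum_(s : 'S_d.+1 | s i0 == i0) t s.
  pose k := (j + (d.+1 - i0))%N.
  have ck : (c ^+ k)%g i0 = j.
    apply: val_inj; rewrite /= iter_c /k addnCA subnKC ?modnDr ?modn_small //.
    exact: ltnW.
  rewrite [RHS](reindex_inj (mulgI (c ^+ k)%g)) /=.
  by apply: eq_big => s; rewrite ?tcX // permM ck.
transitivity (\sum_(j < d.+1) \sum_(s : 'S_d.+1 | s j == i0) t s).
  rewrite (partition_big (fun s : 'S_d.+1 => s^-1%g i0) xpredT) //=.
  apply: eq_bigr => j _; apply: eq_bigl => s.
  by rewrite -(inj_eq (@perm_inj _ s)) permKV eq_sym.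
by rewrite (eq_bigr _ (fun j _ => inner j)) sumr_const card_ord [RHS]mulr_natl.
Qed.

(* The two kinds of rank one matrices have nonzero products only when they
   alternate, in which case a product contracts to a product of scalars. *)
Lemma mulmx_prod_rank1_pairs n N (F : nat -> 'M[R]_n.+1) (al be s : R)
    (v : 'cV[R]_n.+1) (v' : 'rV[R]_n.+1) (u : nat -> 'cV[R]_n.+1)
    (u' : nat -> 'rV[R]_n.+1) :
  v' *m v = s%:M -> (forall i, v' *m u i = 0) -> (forall i, u' i *m v = 0) ->
  (forall i, F i = al *: (u i *m v') + be *: (v *m u' i)) ->
  v' *m \prod_(0 <= i < N.*2) F i =
  (\prod_(0 <= k < N) (al * be * s * (u' k.*2 *m u k.*2.+1) 0 0)) *: v'.
Proof.
move=> v'v v'u u'v FE; elim: N => [|N IHN].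
  by rewrite !big_geq // scale1r; exact: mulmx1.
rewrite doubleS !big_nat_recr //= -!mulmxE !mulmxA IHN -!scalemxAl.
rewrite !FE.
(* From the left, [v'] meets only the second kind of matrix and becomes a row [u' i]; that row meets
   only the first kind and returns a multiple of [v']. *)
have step1 i : v' *m (al *: (u i *m v') + be *: (v *m u' i)) = (be * s) *: u' i.
  rewrite mulmxDr -!scalemxAr !mulmxA v'u mul0mx scaler0 add0r v'v.
  by rewrite mul_scalar_mx scalerA.
have step2 i j : u' i *m (al *: (u j *m v') + be *: (v *m u' j)) =
    (al * (u' i *m u j) 0 0) *: v'.
  rewrite mulmxDr -!scalemxAr !mulmxA u'v mul0mx scaler0 addr0.
  by rewrite {1}[u' i *m u j]mx11_scalar mul_scalar_mx scalerA.
rewrite step1 -scalemxAl step2 !scalerA; congr (_ *: _).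
ring.
Qed.

(** Both sides are the determinant of one bordered matrix, eliminated from either diagonal
    corner. *)
Lemma det_sub_rank1 N (a : 'cV[R]_N) (b : 'rV[R]_N) :
  \det (1%:M - a *m b) = 1 - (b *m a) 0 0.
Proof.
have H1 : block_mx 1%:M b a 1%:M =
    block_mx 1%:M 0 a 1%:M *m block_mx 1%:M b 0 (1%:M - a *m b).
  rewrite mulmx_block !mul1mx !mulmx1 !mul0mx ?mulmx0 !addr0.
  by rewrite addrC subrK.
have H2 : block_mx 1%:M b a 1%:M =
    block_mx 1%:M b 0 1%:M *m block_mx (1%:M - b *m a) 0 a 1%:M.
  rewrite mulmx_block !mul1mx !mulmx1 !mul0mx ?mulmx0 ?add0r ?addr0.
  by rewrite subrK.
have := congr1 determinant H1; rewrite {1}H2 !det_mulmx !det_ublock !det_lblock.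
by rewrite !det1 !mul1r !mulr1 det_mx11 !mxE => ->.
Qed.

(** Translates the block layout (one index, all first members of pairs, all second members) into the
    order theta, x_0, y_0, x_1, y_1, ... of the coordinates. *)
Definition pair_position N (r : 'I_(1 + (N + N))) : 'I_N.*2.+1 :=
  inord (match fintype.split r with
         | inl _ => 0
         | inr q => match fintype.split q with
                    | inl k => k.*2.+1
                    | inr k => k.*2.+2
                    end
         end).

Lemma pair_position0 N : pair_position (lshift (N + N) 0) = ord0.
Proof.
by apply: val_inj; rewrite /pair_position (unsplitK (inl _)) /= inordK.
Qed.

Lemma pair_positionl N (k : 'I_N) :
  pair_position (rshift 1 (lshift N k)) = k.*2.+1 :> nat.
Proof.
rewrite /pair_position (unsplitK (inr _)) (unsplitK (inl _)) inordK // ltnS.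
by rewrite ltn_double.
Qed.

Lemma pair_positionr N (k : 'I_N) :
  pair_position (rshift 1 (rshift N k)) = k.*2.+2 :> nat.
Proof.
rewrite /pair_position (unsplitK (inr _)) (unsplitK (inr _)) inordK // !ltnS.
by rewrite -doubleS leq_double.
Qed.

Lemma pair_position_inj N : injective (@pair_position N).
Proof.
move=> r r' /(congr1 val) /=.
case: (split_ordP r) => i ->; case: (split_ordP r') => i' ->.
- by rewrite !ord1.
- rewrite ord1 pair_position0; case: (split_ordP i') => k ->.
    by rewrite pair_positionl.
  by rewrite pair_positionr.
- rewrite ord1 pair_position0; case: (split_ordP i) => k ->.
    by rewrite pair_positionl.
  by rewrite pair_positionr.
case: (split_ordP i) => k ->; case: (split_ordP i') => k' ->;
  rewrite ?pair_positionl ?pair_positionr.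
- by case=> /double_inj /val_inj ->.
- by case=> /(congr1 odd); rewrite /= !odd_double.
- by case=> /(congr1 odd); rewrite /= !odd_double.
by case=> /double_inj /val_inj ->.
Qed.

(** Intended meaning: [w p] is g^-1 dg on the coordinate field [p], [z j] and [z' j] are dz_j and
    its conjugate on these fields, [I] is the imaginary unit, and [h] is the matrix of the hermitian
    form on the orthogonal parts. Each pair contributes 2 I, as in conj(dz) dz = 2 i dx dy. *)
Lemma wedge_rank1_pairs N (w : 'I_N.*2.+1 -> 'M[R]_N.+1) (c al be s I : R)
    (v : 'cV[R]_N.+1) (v' : 'rV[R]_N.+1)
    (u : 'I_N.*2.+1 -> 'cV[R]_N.+1) (u' : 'I_N.*2.+1 -> 'rV[R]_N.+1)
    (z z' : 'I_N -> 'I_N.*2.+1 -> R) (h : 'M[R]_N) :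
  v' *m v = s%:M -> (forall p, v' *m u p = 0) -> (forall p, u' p *m v = 0) ->
  w ord0 = c *: (v *m v') ->
  (forall p, p != ord0 -> w p = al *: (u p *m v') + be *: (v *m u' p)) ->
  (forall p q, (u' p *m u q) 0 0 =
    \sum_j z' j p * \sum_l h j l * z l q) ->
  (forall j, z j ord0 = 0) -> (forall j, z' j ord0 = 0) ->
  (forall j (k : 'I_N) (p : 'I_N.*2.+1), p = k.*2.+1 :> nat ->
     z j p = (j == k)%:R /\ z' j p = (j == k)%:R) ->
  (forall j (k : 'I_N) (p : 'I_N.*2.+1), p = k.*2.+2 :> nat ->
     z j p = I * (j == k)%:R /\ z' j p = - I * (j == k)%:R) ->
  \sum_(g : 'S_N.*2.+1) (-1) ^+ g * \tr (\prod_(i < N.*2.+1) w (g i)) =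
  N.*2.+1%:R * (c * s * (al * be * s) ^+ N) *
  (N`!%:R * ((2 * I) ^+ N * \det h)).
Proof.
move=> v'v v'u u'v w0 wE uE z0 z'0 zl zr.
(* The condition that [g] fixes [ord0] becomes a factor, so that the sum runs over all permutations
   and is a determinant. *)
pose e (p : 'I_N.*2.+1) : R := (p == ord0)%:R.
pose y j q := \sum_l h j l * z l q.
pose p := @pair_position N.
have p0 : p (lshift _ 0) = ord0 := pair_position0 N.
have dE : N.*2.+1 = (1 + (N + N))%N by rewrite -addnn.
rewrite (sum_sign_mxtrace_prod_cyclic w ord0) /= ?odd_double // -mulrA.
congr (_ * _).
transitivity (c * s * (al * be * s) ^+ N *
  \sum_(g : 'S_N.*2.+1) (-1) ^+ g *
    (e (g (p (lshift _ 0))) *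
     \prod_(k < N) \sum_(j < N)
       z' j (g (p (rshift 1 (lshift N k)))) *
       y j (g (p (rshift 1 (rshift N k)))))).
  rewrite big_mkcond mulr_sumr; apply: eq_bigr => g _.
  rewrite p0 /e; case: eqP => [g0|_]; last by rewrite mul0r !mulr0.
  rewrite mul1r mulrCA; congr (_ * _).
  rewrite big_ord_recl g0 w0.
  (* Position 0 is occupied by [ord0], so the remaining factors start at position 1 and [g] avoids
     [ord0] on them. *)
  pose pos i : 'I_N.*2.+1 := inord i.+1.
  have g_neq0 i : (i < N.*2)%N -> g (pos i) != ord0.
    move=> iN; rewrite -g0 (inj_eq perm_inj); apply/eqP => /(congr1 val).
    by rewrite /= inordK.
  pose F i := al *: (u (g (pos i)) *m v') + be *: (v *m u' (g (pos i))).
  have -> : \prod_(i < N.*2) w (g (lift ord0 i)) = \prod_(0 <= i < N.*2) F i.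
    rewrite big_mkord; apply: eq_bigr => i _.
    have -> : lift ord0 i = pos i by apply: val_inj; rewrite /= inordK ?ltnS.
    by rewrite wE ?g_neq0.
  rewrite -mulmxE -scalemxAl -mulmxA.
  rewrite (mulmx_prod_rank1_pairs N v'v (fun i => v'u (g (pos i)))
    (fun i => u'v (g (pos i))) (fun=> erefl)).
  rewrite linearZ /= -scalemxAr linearZ /= mxtrace_mulC v'v mxtrace_scalar mulr1n.
  rewrite big_mkord big_split /= prodr_const card_ord [X in c * X]mulrC.
  rewrite !mulrA; congr (_ * _); apply: eq_bigr => k _.
  have -> : pos k.*2 = p (rshift 1 (lshift N k)).
    by apply: val_inj; rewrite /= pair_positionl inordK // ltnS ltn_double.
  have -> : pos k.*2.+1 = p (rshift 1 (rshift N k)).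
    apply: val_inj; rewrite /= pair_positionr inordK // !ltnS.
    by rewrite -doubleS leq_double.
  by rewrite uE.
congr (_ * _).
rewrite (sum_sign_prod_pairs e z' y dE (@pair_position_inj N)); congr (_ * _).
(* The block columns are the x and the y directions; the block rows are the values of [z'] and of
   [h] applied to [z]. *)
pose U : 'M[R]_(N + N) := block_mx 1%:M (- I%:M) h (I *: h).
have -> : col_mx (\row_c0 e (p c0))
     (col_mx (\matrix_(j, c0) z' j (p c0)) (\matrix_(j, c0) y j (p c0))) =
   block_mx 1%:M 0 0 U.
  have yl j k : y j (p (rshift 1 (lshift N k))) = h j k.
    rewrite /y (bigD1 k) //= big1 => [|l lk].
      by have [-> _] := zl k k _ (pair_positionl k); rewrite eqxx mulr1 addr0.
    have [-> _] := zl l k _ (pair_positionl k).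
    by rewrite (negbTE lk) mulr0.
  have yr j k : y j (p (rshift 1 (rshift N k))) = I * h j k.
    rewrite /y (bigD1 k) //= big1 => [|l lk].
      have [-> _] := zr k k _ (pair_positionr k).
      by rewrite eqxx mulr1 addr0 mulrC.
    have [-> _] := zr l k _ (pair_positionr k).
    by rewrite (negbTE lk) !mulr0.
  apply/matrixP => i j.
  case: (split_ordP i) => {}i ->; case: (split_ordP j) => {}j ->.
  - by rewrite col_mxEu block_mxEul !mxE !ord1 p0 /e !eqxx.
  - rewrite col_mxEu block_mxEur !mxE /e; case: eqP => // /(congr1 val) /=.
    case: (split_ordP j) => k ->; first by rewrite pair_positionl.
    by rewrite pair_positionr.
  - rewrite col_mxEd block_mxEdl ord1.
    case: (split_ordP i) => k ->; rewrite ?col_mxEu ?col_mxEd !mxE.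
      by rewrite p0 z'0.
    by rewrite p0 /y big1 // => l _; rewrite z0 mulr0.
  rewrite col_mxEd block_mxEdr /U.
  case: (split_ordP i) => k ->; case: (split_ordP j) => l ->;
    rewrite ?block_mxEul ?block_mxEur ?block_mxEdl ?block_mxEdr
      ?col_mxEu ?col_mxEd !mxE ?yl ?yr //.
    by have [_ ->] := zl k l _ (pair_positionl l).
  by have [_ ->] := zr k l _ (pair_positionr l); rewrite mulNr mulr_natr.
rewrite det_ublock det1 mul1r.
(* Adding [I] times the first block column of [U] to the second clears the upper right block and
   doubles the lower right one. *)
have -> : U = block_mx 1%:M 0 h ((2 * I) *: h) *m block_mx 1%:M (- I%:M) 0 1%:M.
  rewrite mulmx_block !mul1mx !mulmx1 !mul0mx !mulmx0 !addr0 mulmxN mul_mx_scalar.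
  by rewrite mulrDl mul1r scalerDl addKr.
by rewrite det_mulmx det_ublock det_lblock !det1 !mul1r mulr1 detZ.
Qed.

End AlternatingSums.

(** * Rotations about a line and their logarithmic differentials *)

Section RankOneRotation.
Variables (F : fieldType) (n : nat).
Implicit Types (v w : 'cV[F]_n).

Lemma mulmx_rv_cv (a : 'rV[F]_n) (b : 'cV[F]_n) : a *m b = ((a *m b) 0 0)%:M.
Proof. exact: mx11_scalar. Qed.

Definition rank1_proj v (v' : 'rV[F]_n) : 'M[F]_n :=
  ((v' *m v) 0 0)^-1 *: (v *m v').

Definition rotation l v (v' : 'rV[F]_n) : 'M[F]_n :=
  l *: rank1_proj v v' + (1%:M - rank1_proj v v').

Lemma rank1_projP v (v' : 'rV[F]_n) : (v' *m v) 0 0 != 0 ->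
  rank1_proj v v' *m v = v /\ v' *m rank1_proj v v' = v'.
Proof.
move=> c0; rewrite /rank1_proj; split.
  rewrite -scalemxAl -mulmxA {2}[v' *m v]mulmx_rv_cv mul_mx_scalar scalerA.
  by rewrite mulVf // scale1r.
rewrite -scalemxAr mulmxA {2}[v' *m v]mulmx_rv_cv mul_scalar_mx scalerA.
by rewrite mulVf // scale1r.
Qed.

Lemma rank1_proj_idem v (v' : 'rV[F]_n) : (v' *m v) 0 0 != 0 ->
  rank1_proj v v' *m rank1_proj v v' = rank1_proj v v'.
Proof.
move=> c0; have [Pv _] := rank1_projP c0.
by rewrite {2}/rank1_proj -scalemxAr mulmxA Pv.
Qed.

Lemma rotationM l1 l2 v (v' : 'rV[F]_n) : (v' *m v) 0 0 != 0 ->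
  rotation l1 v v' *m rotation l2 v v' = rotation (l1 * l2) v v'.
Proof.
move=> c0; have P2 := rank1_proj_idem c0; rewrite /rotation.
move: (rank1_proj v v') P2 => P P2.
rewrite !mulmxDl !mulmxDr !mulNmx !mulmxN -!scalemxAl -!scalemxAr.
rewrite !mul1mx !mulmx1 P2.
by apply/matrixP => i j; rewrite !mxE; ring.
Qed.

Lemma rotation1 v (v' : 'rV[F]_n) : rotation 1 v v' = 1%:M.
Proof. by rewrite /rotation scale1r addrC subrK. Qed.

Lemma invmx_rotation l v (v' : 'rV[F]_n) : (v' *m v) 0 0 != 0 -> l != 0 ->
  invmx (rotation l v v') = rotation l^-1 v v'.
Proof.
move=> c0 l0.
have e : rotation l v v' *m rotation l^-1 v v' = 1%:M.
  by rewrite rotationM // mulfV // rotation1.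
have [gu _] := mulmx1_unit e.
by rewrite -[RHS](mulKmx gu) e mulmx1.
Qed.

Definition orth_part v (v' : 'rV[F]_n) w : 'cV[F]_n :=
  w - (((v' *m v) 0 0)^-1 * (v' *m w) 0 0) *: v.

Definition orth_row v (v' w' : 'rV[F]_n) : 'rV[F]_n :=
  w' - (((v' *m v) 0 0)^-1 * (w' *m v) 0 0) *: v'.

Lemma sub_scale_mx11 (B A : 'M[F]_1) : B 0 0 != 0 ->
  A - ((B 0 0)^-1 * A 0 0) *: B = 0.
Proof.
by move=> B0; apply/matrixP => i j; rewrite !mxE !ord1 mulrAC mulVf // mul1r subrr.
Qed.

Lemma mulmx_orth_part v (v' : 'rV[F]_n) w : (v' *m v) 0 0 != 0 ->
  v' *m orth_part v v' w = 0.
Proof.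
by move=> c0; rewrite /orth_part mulmxBr -scalemxAr sub_scale_mx11.
Qed.

Lemma mulmx_orth_row v (v' w' : 'rV[F]_n) : (v' *m v) 0 0 != 0 ->
  orth_row v v' w' *m v = 0.
Proof.
by move=> c0; rewrite /orth_row mulmxBl -scalemxAl sub_scale_mx11.
Qed.

Lemma rotation_mul_v l v (v' : 'rV[F]_n) : (v' *m v) 0 0 != 0 ->
  rotation l v v' *m v = l *: v.
Proof.
move=> c0; have [Pv _] := rank1_projP c0.
by rewrite /rotation mulmxDl mulmxBl -scalemxAl Pv mul1mx subrr addr0.
Qed.

Lemma rotation_mul_orth l v (v' : 'rV[F]_n) w : (v' *m v) 0 0 != 0 ->
  rotation l v v' *m orth_part v v' w = orth_part v v' w.
Proof.
move=> c0; rewrite /rotation mulmxDl mulmxBl -scalemxAl mul1mx.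
rewrite /rank1_proj -scalemxAl -mulmxA mulmx_orth_part //.
by rewrite mulmx0 !scaler0 add0r subr0.
Qed.

(** The differential of [rank1_proj] in the direction [(w, w')], in the shape that the product and
    inverse rules produce. *)
Definition drank1_proj v (v' : 'rV[F]_n) w (w' : 'rV[F]_n) : 'M[F]_n :=
  (- ((v' *m v) 0 0) ^- 2 * (w' *m v + v' *m w) 0 0) *: (v *m v') +
  ((v' *m v) 0 0)^-1 *: (w *m v' + v *m w').

(** The projection does not change when [v] and [v'] are rescaled, so the components of [w] along
    [v] and of [w'] along [v'] cancel. *)
Lemma drank1_projE v (v' : 'rV[F]_n) w (w' : 'rV[F]_n) :
  (v' *m v) 0 0 != 0 ->
  drank1_proj v v' w w' = ((v' *m v) 0 0)^-1 *:
    (orth_part v v' w *m v' + v *m orth_row v v' w').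
Proof.
move=> c0; rewrite /drank1_proj /orth_part /orth_row [X in - _ * X]mxE.
move: ((v' *m v) 0 0) ((w' *m v) 0 0) ((v' *m w) 0 0) c0 => c a b c0.
rewrite mulmxBl mulmxBr -scalemxAl -scalemxAr.
move: (v *m v') (w *m v') (v *m w') => V A B.
apply/matrixP => i j; rewrite !mxE; by field.
Qed.

(** The inverse rotation fixes the orthogonal part and multiplies [v] by [l^-1]; this turns the
    common factor l - 1 into 1 - l^-1 in the second term only. *)
Lemma invmx_rotation_mul_drotation l v (v' : 'rV[F]_n) w (w' : 'rV[F]_n) :
  (v' *m v) 0 0 != 0 -> l != 0 ->
  invmx (rotation l v v') *m ((l - 1) *: drank1_proj v v' w w') =
  ((l - 1) / (v' *m v) 0 0) *: (orth_part v v' w *m v') +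
  ((1 - l^-1) / (v' *m v) 0 0) *: (v *m orth_row v v' w').
Proof.
move=> c0 l0; rewrite invmx_rotation // drank1_projE // -!scalemxAr scalerA.
rewrite mulmxDr !mulmxA rotation_mul_orth // rotation_mul_v // scalerDr.
rewrite -scalemxAl scalerA; congr (_ + _ *: _).
by rewrite mulrAC mulrBl mulfV // mul1r.
Qed.

(** The theta direction: the derivative of [l] is [a * l] with [a] the imaginary unit. *)
Lemma invmx_rotation_mul_proj l a v (v' : 'rV[F]_n) :
  (v' *m v) 0 0 != 0 -> l != 0 ->
  invmx (rotation l v v') *m ((a * l) *: rank1_proj v v') =
  (a / (v' *m v) 0 0) *: (v *m v').
Proof.
move=> c0 l0; rewrite invmx_rotation // /rank1_proj -!scalemxAr mulmxA.
by rewrite rotation_mul_v // -scalemxAl !scalerA; congr (_ *: _); field; rewrite c0.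
Qed.

Lemma orth_row_mul_orth_part v (v' : 'rV[F]_n) w (w' : 'rV[F]_n) :
  (v' *m v) 0 0 != 0 ->
  (orth_row v v' w' *m orth_part v v' w) 0 0 =
  (w' *m w) 0 0 - ((v' *m v) 0 0)^-1 * (w' *m v) 0 0 * (v' *m w) 0 0.
Proof.
move=> c0; rewrite {1}/orth_row mulmxBl -scalemxAl (mulmx_orth_part _ c0) scaler0.
rewrite subr0 /orth_part mulmxBr -scalemxAr mxE [X in _ + X]mxE [X in _ - X]mxE.
by ring.
Qed.

End RankOneRotation.

(* The wedge of [wedge_rank1_pairs] with the index type ['I_d] known to be
   ['I_N.*2.+1] only up to a propositional equality. *)
Lemma wedge_rank1_pairs_dim (R : comNzRingType) N d
    (w : 'I_d -> 'M[R]_N.+1) (c al be s I : R)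
    (v : 'cV[R]_N.+1) (v' : 'rV[R]_N.+1)
    (u : 'I_d -> 'cV[R]_N.+1) (u' : 'I_d -> 'rV[R]_N.+1)
    (z z' : 'I_N -> nat -> R) (h : 'M[R]_N) :
  d = N.*2.+1 ->
  v' *m v = s%:M -> (forall p, v' *m u p = 0) -> (forall p, u' p *m v = 0) ->
  (forall p : 'I_d, p = 0%N :> nat -> w p = c *: (v *m v')) ->
  (forall p : 'I_d, p != 0%N :> nat ->
     w p = al *: (u p *m v') + be *: (v *m u' p)) ->
  (forall p q, (u' p *m u q) 0 0 =
    \sum_j z' j p * \sum_l h j l * z l q) ->
  (forall j, z j 0%N = 0) -> (forall j, z' j 0%N = 0) ->
  (forall j (k : 'I_N),
     z j k.*2.+1 = (j == k)%:R /\ z' j k.*2.+1 = (j == k)%:R) ->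
  (forall j (k : 'I_N),
     z j k.*2.+2 = I * (j == k)%:R /\ z' j k.*2.+2 = - I * (j == k)%:R) ->
  \sum_(g : 'S_d) (-1) ^+ g * \tr (\prod_(i < d) w (g i)) =
  d%:R * (c * s * (al * be * s) ^+ N) * (N`!%:R * ((2 * I) ^+ N * \det h)).
Proof.
move=> dE; subst d => v'v v'u u'v w0 wE uE z0 z'0 zl zr.
apply: (wedge_rank1_pairs (z := fun j p => z j p) (z' := fun j p => z' j p)
  v'v v'u u'v) => //.
- exact: w0.
- by move=> j k p ->; exact: zl.
- by move=> j k p ->; exact: zr.
Qed.

(** * Integrals *)

Section RealIntegrals.
Variable R : realType.
Local Notation mu := (@lebesgue_measure R).

Lemma integral_expRN_sqr (t : R) : 0 < t ->
  (\int[mu]_x (expR (- t * x ^+ 2))%:E = (Num.sqrt (pi / t))%:E)%E.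
Proof.
(* The standard deviation of the centered normal law whose density is proportional to exp(- t
   x^2). *)
move=> t0; pose s : R := Num.sqrt (t^-1 / 2).
have s2 : s ^+ 2 *+ 2 = t^-1.
  by rewrite sqr_sqrtr ?divr_ge0 ?invr_ge0 ?(ltW t0)// -mulr_natr divfK.
have s0 : s != 0 by rewrite gt_eqF// sqrtr_gt0 divr_gt0 ?invr_gt0.
have pdf1 := integral_normal_pdf 0 s.
have pE : normal_peak s = (Num.sqrt (pi / t))^-1.
  by rewrite /normal_peak -mulrnAl s2 mulrC.
have p0 : Num.sqrt (pi / t) != 0 by rewrite gt_eqF// sqrtr_gt0 divr_gt0 ?pi_gt0.
transitivity (\int[mu]_x ((Num.sqrt (pi / t))%:E * (normal_pdf 0 s x)%:E))%E.
  apply: eq_integral => x _; rewrite -EFinM /normal_pdf (negbTE s0) /= pE mulVKf//.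
  by rewrite /normal_fun s2 invrK subr0 mulrC mulrN mulNr mulrC.
rewrite ge0_integralZl//.
- by rewrite pdf1 mule1.
- by apply/measurable_EFinP; exact: measurable_normal_pdf.
- by move=> x _; rewrite lee_fin normal_pdf_ge0.
Qed.

Lemma cvg_exprM_expRN (a : R) k : 0 < a ->
  x ^+ k * expR (- a * x) @[x --> +oo] --> (0 : R).
Proof.
(* The Taylor bound exp(a x) >= (a x)^(k + 1) / (k + 1)! leaves exactly c / x. *)
move=> a0; pose c : R := (k.+1)`!%:R / a ^+ k.+1.
have cx0 : c * x^-1 @[x --> +oo] --> (0 : R).
  rewrite -(mulr0 c); apply: cvgM; first exact: cvg_cst.
  apply/gtr0_cvgV0; [|exact: cvg_id].
  by near=> x; near: x; exact: nbhs_pinfty_gt.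
apply: (@squeeze_cvgr _ _ _ _ (cst 0) (fun x => c * x^-1)) => //; last first.
  exact: cvg_cst.
near=> x; have x0 : 0 < x by near: x; exact: nbhs_pinfty_gt.
rewrite /cst mulr_ge0 ?expR_ge0 ?exprn_ge0 ?(ltW x0)//=.
have := expR_ge1Dxn k (ltW (mulr_gt0 a0 x0)) => h.
have {}h : (a * x) ^+ k.+1 / k.+1`!%:R <= expR (a * x).
  by apply: le_trans h; rewrite lerDr.
rewrite mulNr expRN ler_pdivrMr ?expR_gt0// /c.
apply: le_trans (ler_wpM2l _ h).
  rewrite le_eqVlt; apply/orP; left; apply/eqP; rewrite exprMn.
  have : k.+1`!%:R != 0 :> R by rewrite pnatr_eq0 -lt0n fact_gt0.
  move: (k.+1`!%:R) => f f0; rewrite [x ^+ k.+1]exprS.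
  by field; rewrite f0 expf_neq0 ?gt_eqF.
by rewrite mulr_ge0 ?invr_ge0 ?divr_ge0 ?exprn_ge0 ?(ltW a0) ?(ltW x0) ?ler0n.
Unshelve. all: by end_near. Qed.

Lemma integral_exprM_expRN (a : R) k : 0 < a ->
  (\int[mu]_(x in `[0%R, +oo[) (x ^+ k * expR (- a * x))%:E =
   (k`!%:R / a ^+ k.+1)%:E)%E.
Proof.
move=> a0; have an0 : a != 0 by rewrite gt_eqF.
have dexp (x : R) : is_derive x 1 (fun y => expR (- a * y)) (- a * expR (- a * x)).
  have h : is_derive x 1 ( *%R (- a)) (- a : R).
    by apply: is_derive_eq; rewrite ?scaler1.
  by apply: is_derive_eq; rewrite [RHS]mulrC.
(* A primitive vanishing at infinity, built by integrating by parts at each step of the induction;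
   the integral is [- F 0]. *)
have [F [dF F0 Fy]] : exists F : R -> R,
    [/\ forall x : R, is_derive x 1 F (x ^+ k * expR (- a * x)),
        F 0 = - (k`!%:R / a ^+ k.+1) & F x @[x --> +oo] --> (0 : R)].
  elim: k => [|k [F [dF F0 Fy]]].
    exists (fun x => - a^-1 * expR (- a * x)); split.
    - move=> x; apply: is_derive_eq; rewrite expr0 mul1r /GRing.scale /=.
      by rewrite mulrA mulrNN mulVf// mul1r.
    - by rewrite mulr0 expR0 mulr1 fact0 div1r expr1.
    - rewrite -(mulr0 (- a^-1)); apply: cvgM; first exact: cvg_cst.
      by have := @cvg_exprM_expRN a 0 a0; under eq_fun do rewrite expr0 mul1r.
  exists (fun x => a^-1 * (k.+1%:R * F x - x ^+ k.+1 * expR (- a * x))); split.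
  - move=> x.
    have h1 := is_deriveM (is_derive_cst (k.+1%:R : R) x 1) (dF x).
    have hX := is_deriveX k.+1 (is_derive_id x (1 : R)).
    rewrite exprfctE in hX; have h2 := is_deriveM hX (dexp x).
    have h3 := is_deriveM (is_derive_cst (a^-1 : R) x 1) (is_deriveB h1 h2).

    apply: (is_derive_eq h3); rewrite /GRing.scale /= /cst /=.
    by rewrite [x ^+ k.+1]exprS; field.
  - rewrite F0 expr0n mul0r subr0 factS natrM [a ^+ k.+2]exprS.
    by field; rewrite an0 expf_neq0.
  - rewrite -(mulr0 a^-1); apply: cvgM; first exact: cvg_cst.
    rewrite -(subr0 0); apply: cvgB; last exact: cvg_exprM_expRN.
    by rewrite -(mulr0 (k.+1%:R : R)); apply: cvgM => //; exact: cvg_cst.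
have cF x : {for x, continuous F}.
  by apply/differentiable_continuous/derivable1_diffP; have [] := dF x.
rewrite (@ge0_continuous_FTC2y _ _ F _ 0).
- by rewrite F0 -EFinB sub0r opprK.
- by move=> x x0; rewrite mulr_ge0 ?expR_ge0// exprn_ge0.
- apply: continuous_subspaceT => x; apply: cvgM; first exact: exprn_continuous.
  suff : {for x, continuous (fun y => expR (- a * y))} by [].
  by apply/differentiable_continuous/derivable1_diffP; have [] := dexp x.
- exact: Fy.
- by move=> x _; have [] := dF x.
- exact/cvg_at_right_filter/cF.
- by move=> x _; rewrite derive1E; have [_ ->] := dF x.
Qed.

Lemma sin_2pi : sin (2 * pi) = 0 :> R.
Proof. by rewrite mulr_natl sin2pi. Qed.

Lemma integral_expr_2sub2cos k :
  (\int[mu]_(x in `]0%R, (2 * pi)%R[) ((2 - 2 * cos x) ^+ k)%:E =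
   (2 * pi * ((k.*2)`!%:R / k`!%:R ^+ 2))%:E)%E.
Proof.
pose m (x : R) := 2 - 2 * cos x.
have dm (x : R) : is_derive x 1 m (2 * sin x).
  have h := is_deriveB (is_derive_cst (2 : R) x 1)
    (is_deriveM (is_derive_cst (2 : R) x 1) (is_derive_cos x)).
  by apply: (is_derive_eq h); rewrite /GRing.scale /= /cst /=; ring.
have cont (f df : R -> R) (x : R) : is_derive x 1 f (df x) -> {for x, continuous f}.
  by move=> [dfx _]; apply/differentiable_continuous/derivable1_diffP.
have dmX j (x : R) :
    is_derive x 1 (fun y => m y ^+ j) (j%:R * m x ^+ j.-1 * (2 * sin x)).
  have h := is_deriveX j (dm x); rewrite exprfctE in h.
  by apply: (is_derive_eq h); rewrite /GRing.scale /=.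
have [F [dF FE]] : exists F : R -> R, (forall x : R, is_derive x 1 F (m x ^+ k)) /\
    F (2 * pi) - F 0 = 2 * pi * ((k.*2)`!%:R / k`!%:R ^+ 2).
  elim: k => [|k [F [dF FE]]].
    exists id; split; last by rewrite fact0 expr1n divr1 subr0 mulr1.
    by move=> x; apply: is_derive_eq; rewrite expr0.
  (* Integration by parts relates the exponents k + 1 and k with the coefficient 2 (2 k + 1) / (k +
     1), the ratio of consecutive central binomial coefficients; the boundary term vanishes at 0 and
     2 pi with the sine. *)
  exists (fun x => k.+1%:R^-1 * (2 * k.*2.+1%:R * F x - 2 * (sin x * m x ^+ k))).
  split.
    move=> x.
    have h1 := is_deriveM (is_derive_cst (2 * k.*2.+1%:R : R) x 1) (dF x).
    have h2 := is_deriveM (is_derive_cst (2 : R) x 1)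
      (is_deriveM (is_derive_sin x) (dmX k x)).
    have h3 := is_deriveM (is_derive_cst (k.+1%:R^-1 : R) x 1) (is_deriveB h1 h2).
    apply: (is_derive_eq h3); rewrite /GRing.scale /= /cst /=.
    have k0 : k.+1%:R != 0 :> R by rewrite pnatr_eq0.
    apply: (mulfI k0); rewrite !mulr0 !addr0 mulVKf// exprS.
    (* Since 2 sin^2 x = m x (1 + cos x), the lost power of [m x] is restored. For k = 0, where
       [k.-1] is truncated, both sides vanish. *)
    have sE : sin x * (k%:R * m x ^+ k.-1 * (2 * sin x)) =
        k%:R * m x ^+ k * (1 + cos x).
      case: k {dF FE h1 h2 h3 k0} => [|j]; first by rewrite !mul0r mulr0.
      have s2 := sin2cos2 x; rewrite [in RHS]exprS /m /=.
      transitivity (j.+1%:R * m x ^+ j * 2 * (sin x ^+ 2)); first by rewrite /m; ring.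
      by rewrite s2 /m; ring.
    have -> : k.*2.+1%:R = 2 * k%:R + 1 :> R by rewrite -natr1 -mul2n natrM.
    have -> : k.+1%:R = k%:R + 1 :> R by rewrite natr1.
    by rewrite sE; move: (m x ^+ k) => y; rewrite /m; ring.
  rewrite sin_2pi sin0 !mul0r !mulr0 !subr0 -!mulrBr FE.
  rewrite doubleS !factS !natrM -!natr1 -!muln2 !natrM.
  have : k`!%:R != 0 :> R by rewrite pnatr_eq0 -lt0n fact_gt0.
  have k1 : k%:R + 1 != 0 :> R by rewrite natr1 pnatr_eq0.
  move: (k`!%:R) ((k*2)`!%:R) (k%:R : R) k1 => a b c k1 a0.
  by field; rewrite k1 a0.
have cF (x : R) : {for x, continuous F} by exact: (cont _ (fun x => m x ^+ k)).
have cm (x : R) : {for x, continuous (fun y => m y ^+ k)}.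
  exact: (cont _ (fun x => k%:R * m x ^+ k.-1 * (2 * sin x))).
have pi2 : 0 < 2 * pi :> R by rewrite mulr_gt0 ?pi_gt0.
rewrite -(@integral_itv_bndoo R 0 (2 * pi) _ true false); last first.
  have mm : measurable_fun [set: R] (fun y => m y ^+ k).
    by apply: continuous_measurable_fun => x; exact: cm.
  by apply/measurable_EFinP; exact: measurable_funTS mm.
rewrite (@continuous_FTC2 _ _ F) // -?EFinB ?FE //.
- by apply: continuous_subspaceT => x; exact: cm.
- split; first by move=> x _; have [] := dF x.
    exact/cvg_at_right_filter/cF.
  exact/cvg_at_left_filter/cF.
- by move=> x _; rewrite derive1E; have [_ ->] := dF x.
Qed.

End RealIntegrals.

(** * Integrals over R^d by slicing off one coordinate *)

Section LebesgueTupleIntegrals.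
Variable R : realType.
Local Notation mu := (@lebesgue_measure R).
Local Notation lt := (lebesgue_tuple R).
Local Notation T d := (d.-tuple (measurableTypeR R)).

Lemma ge0_integral_lebesgue_tupleS d (F : T d.+1 -> \bar R) :
  measurable_fun [set: T d.+1] F -> (forall t, 0 <= F t)%E ->
  (\int[lt d.+1]_t F t = \int[mu]_x \int[lt d]_u F (consp (x, u)))%E.
Proof.
move=> mF F0; have mc := @measurable_consp R d.
transitivity (\int[pushforward (mu \x lt d) (@consp R d)]_t F t)%E; first by [].
rewrite (ge0_integral_pushforward mc) //.
have mFc := measurableT_comp mF mc.
by rewrite preimage_setT (fubini_tonelli1 _ mFc (fun=> F0 _)).
Qed.

(** The hyperplane is a product with one null factor, and 0 times infinity is 0 in the extended
    reals. *)
Lemma lebesgue_tuple_coord0 d (i : 'I_d) : lt d [set t | tnth t i = 0] = 0%E.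
Proof.
elim: d i => [|d IHd] i; first by case: i.
case: (unliftP ord0 i) => [j ->|->].
  rewrite /= /lebesgue_cons /pushforward.
  rewrite (_ : _ @^-1` _ = setT `*` [set u : T d | tnth u j = 0]).
    rewrite product_measure1E // ?IHd ?mule0 //.
    have := @measurable_tnth _ (measurableTypeR R) d j measurableT [set 0].
    by rewrite setTI; apply; exact: measurable_set1.
  by apply/seteqP; split => -[x u] /=; rewrite tnthS => // -[].
rewrite /= /lebesgue_cons /pushforward.
rewrite (_ : _ @^-1` _ = [set 0] `*` setT).
  rewrite product_measure1E // [X in (X * _)%E](_ : _ = 0%E) ?mul0e //.
  exact: (lebesgue_measure_set1 (0 : R)).
by apply/seteqP; split => -[x u] //= [].
Qed.

Definition tuple_sqnorm d (u : d.-tuple R) : R := \sum_(i < d) tnth u i ^+ 2.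

Lemma tuple_sqnorm_ge0 d (u : d.-tuple R) : 0 <= tuple_sqnorm u.
Proof. by apply: sumr_ge0 => i _; exact: sqr_ge0. Qed.

Lemma tuple_sqnorm_consp d x (u : T d) :
  tuple_sqnorm (consp (x, u)) = x ^+ 2 + tuple_sqnorm u.
Proof.
rewrite /tuple_sqnorm big_ord_recl tnth0; congr (_ + _).
by apply: eq_bigr => i _; rewrite tnthS.
Qed.

Lemma measurable_tuple_sqnorm d :
  measurable_fun [set: T d] (@tuple_sqnorm d : T d -> R).
Proof.
apply: measurable_sum => i; apply: measurable_funX.
exact: (@measurable_tnth _ (measurableTypeR R) d i).
Qed.

Lemma measurable_expRN_sqnorm d (t : R) :
  measurable_fun [set: T d] (fun u : T d => expR (- t * tuple_sqnorm u)).
Proof.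
apply: measurableT_comp => //; apply: measurable_funM => //.
exact: measurable_tuple_sqnorm.
Qed.

Lemma integral_expRN_sqnorm d (t : R) : 0 < t ->
  (\int[lt d]_u (expR (- t * tuple_sqnorm u))%:E =
   (Num.sqrt (pi / t) ^+ d)%:E)%E.
Proof.
move=> t0; elim: d => [|d IHd].
  rewrite integral_dirac //.
    by rewrite diracT mul1e /tuple_sqnorm big_ord0 mulr0 expR0 expr0.
  by apply/measurable_EFinP; exact: measurable_expRN_sqnorm.
rewrite ge0_integral_lebesgue_tupleS; last 2 first.
- by apply/measurable_EFinP; exact: measurable_expRN_sqnorm.
- by move=> u; rewrite lee_fin expR_ge0.
transitivity (\int[mu]_x ((expR (- t * x ^+ 2))%:E *
    (Num.sqrt (pi / t) ^+ d)%:E))%E.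
  apply: eq_integral => x _; rewrite -IHd.
  rewrite -ge0_integralZl //;
    last by apply/measurable_EFinP; exact: measurable_expRN_sqnorm.
  apply: eq_integral => u _.
  by rewrite tuple_sqnorm_consp mulrDr expRD EFinM.
rewrite ge0_integralZr //; last first.
  apply/measurable_EFinP; apply: measurableT_comp => //.
  by apply: measurable_funM => //; exact: measurable_funX.
by rewrite integral_expRN_sqr // -EFinM exprS.
Qed.

(* The factor (1 + |u|^2)^-(N + 1) is turned into Gaussians by
   N! / a^(N + 1) = \int_0^oo t^N e^(- a t) dt. *)
Lemma integral_inv_1sqnorm N :
  (\int[lt N.*2]_u ((1 + tuple_sqnorm u) ^- N.+1)%:E =
   (pi ^+ N / N`!%:R)%:E)%E.
Proof.
pose D : set R := `]0%R, +oo[%classic.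
have mD : measurable D by exact: measurable_itv.
pose g (u : T N.*2) (t : R) : R := t ^+ N * expR (- (1 + tuple_sqnorm u) * t).
(* The restriction to t > 0 enters as an indicator, so that Tonelli applies on the whole product. *)
pose f (p : T N.*2 * measurableTypeR R) : \bar R := (g p.1 p.2 * \1_D p.2)%:E.
have g0 u t : D t -> 0 <= g u t.
  rewrite /D /= in_itv /= andbT => t0.
  by rewrite mulr_ge0 ?expR_ge0 ?exprn_ge0 ?ltW.
have f0 p : (0 <= f p)%E.
  rewrite lee_fin /f indicE; case: (boolP (p.2 \in D)) => /= pD; last first.
    by rewrite mulr0.
  by rewrite mulr1 g0 //; rewrite inE in pD.
have mf : measurable_fun [set: T N.*2 * measurableTypeR R] f.
  apply/measurable_EFinP; apply: measurable_funM; last first.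
    exact: measurableT_comp (measurable_indic mD) measurable_snd.
  apply: measurable_funM; first by apply: measurable_funX; exact: measurable_snd.
  apply: measurableT_comp => //; apply: measurable_funM; last exact: measurable_snd.
  apply: measurableT_comp => //; apply: measurable_funD => //.
  exact: measurableT_comp (@measurable_tuple_sqnorm _) measurable_fst.
have a0 (u : T N.*2) : 0 < 1 + tuple_sqnorm u.
  by rewrite ltr_wpDr // tuple_sqnorm_ge0.
have Nf0 : N`!%:R != 0 :> R by rewrite pnatr_eq0 -lt0n fact_gt0.
have mexp (a : R) k : measurable_fun [set: R] (fun t => t ^+ k * expR (- a * t)).
  apply: measurable_funM; first exact: measurable_funX.
  by apply: measurableT_comp => //; exact: measurable_funM.
have gamma k a : 0 < a ->
    (\int[mu]_(t in D) (t ^+ k * expR (- a * t))%:E = (k`!%:R / a ^+ k.+1)%:E)%E.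
  move=> ?; rewrite -integral_exprM_expRN // integral_itv_obnd_cbnd //.
  by apply/measurable_EFinP; exact: measurable_funTS (mexp a k).
have inner1 u : (\int[mu]_t f (u, t) = (N`!%:R / (1 + tuple_sqnorm u) ^+ N.+1)%:E)%E.
  rewrite -gamma // [RHS]integral_mkcond; apply: eq_integral => t _.
  rewrite /f /= patchE indicE; case: (t \in D); by rewrite ?mulr1 ?mulr0.
(* The Gaussian integral in dimension 2 N is (pi / t)^N, whose denominator cancels [t ^+ N]. *)
have inner2 t : (\int[lt N.*2]_u f (u, t) = (pi ^+ N * (expR (- t) * \1_D t))%:E)%E.
  rewrite /f /= indicE; case: (boolP (t \in D)) => tD; last first.
    by rewrite !mulr0 integral0_eq // => u _; rewrite mulr0.
  have t0 : 0 < t by move: tD; rewrite inE /D /= in_itv /= andbT.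
  transitivity (\int[lt N.*2]_u ((t ^+ N * expR (- t))%:E *
      (expR (- t * tuple_sqnorm u))%:E))%E.
    apply: eq_integral => u _; rewrite -EFinM; congr EFin.
    by rewrite mulr1 /g -[RHS]mulrA -expRD; congr (_ * expR _); ring.
  rewrite ge0_integralZl //; last 2 first.
  - by apply/measurable_EFinP; exact: measurable_expRN_sqnorm.
  - by rewrite lee_fin mulr_ge0 ?expR_ge0 ?exprn_ge0 ?ltW.
  rewrite integral_expRN_sqnorm // -EFinM; congr EFin.
  rewrite -mul2n exprM sqr_sqrtr ?divr_ge0 ?pi_ge0 ?ltW // expr_div_n mulr1.
  by field; rewrite expf_neq0 // gt_eqF.
transitivity (\int[lt N.*2]_u ((N`!%:R^-1)%:E * \int[mu]_t f (u, t)))%E.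
  apply: eq_integral => u _; rewrite inner1 -EFinM; congr EFin.
  by rewrite mulrA mulVf // mul1r.
rewrite ge0_integralZl //; last 2 first.
- exact: (measurable_fun_fubini_tonelli_F (m2 := mu) f mf f0).
- by move=> u _; apply: integral_ge0.
rewrite (fubini_tonelli (m1 := lt N.*2) (m2 := mu) f mf f0).
transitivity ((N`!%:R^-1)%:E *
    \int[mu]_t ((pi ^+ N)%:E * ((fun t => (expR (- t))%:E) \_ D) t))%E.
  congr (_ * _)%E; apply: eq_integral => t _; rewrite inner2 patchE indicE.
  by case: (t \in D); rewrite -?EFinM ?mulr1 ?mulr0 ?mule0.
rewrite ge0_integralZl //; last 3 first.
- apply/(measurable_restrictT _ mD); apply/measurable_EFinP.
  by apply: measurable_funTS; apply: measurableT_comp.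
- by move=> t _; apply: erestrict_ge0 => x _; rewrite lee_fin expR_ge0.
- by rewrite lee_fin exprn_ge0 // pi_ge0.
rewrite -integral_mkcond (_ : \int[mu]_(t in D) _ = 1)%E.
  by rewrite mule1 -EFinM mulrC.
rewrite -[RHS](_ : (0`!%:R / 1 ^+ 1)%:E = 1%E); last by rewrite expr1n divr1.
rewrite -gamma //; apply: eq_integral => t _.
by rewrite expr0 mul1r mulN1r.
Qed.

(** Positivity keeps [h] in the open half line, where y^-n is continuous. *)
Lemma measurable_fun_exprVn dsp (U : measurableType dsp) (h : U -> R) n :
  measurable_fun setT h -> (forall u, 0 < h u) ->
  measurable_fun setT (fun u => h u ^- n).
Proof.
move=> mh h0.
have mpow : measurable_fun (`]0%R, +oo[%classic : set R) (fun y : R => y ^- n).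
  apply: open_continuous_measurable_fun => //.
  move=> y; rewrite inE /= in_itv /= andbT => y0.
  apply: cvgV; first by rewrite expf_neq0 // gt_eqF.
  exact: exprn_continuous.
have hsub : h @` setT `<=` `]0%R, +oo[%classic.
  by move=> _ [u _ <-]; rewrite /= in_itv /= andbT.
refine (measurable_comp _ hsub mpow mh).
exact: measurable_itv.
Qed.

Lemma measurable_cos : measurable_fun [set: R] (@cos R).
Proof. by apply: continuous_measurable_fun => x; exact: continuous_cos. Qed.

Lemma measurable_nth_tuple d j :
  measurable_fun [set: T d] (fun t : T d => nth 0 t j : R).
Proof.
have [jd|dj] := ltnP j d; last first.
  rewrite (_ : (fun _ => _) = cst 0) //.
  by apply/funext => t; rewrite nth_default // size_tuple.
rewrite (_ : (fun _ => _) = (@tnth d R)^~ (Ordinal jd)).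
  exact: (@measurable_tnth _ (measurableTypeR R) d (Ordinal jd)).
by apply/funext => t; rewrite (tnth_nth 0).
Qed.

(** For the chart of index k it is taken at [k.*2]: two real coordinates for each of the vanishing
    z_0, ..., z_(k-1). *)
Definition chart_cell d k : set (T d) :=
  [set t | 0 < (nth 0 t 0 : R) < 2 * pi /\
           forall j, (0 < j <= k)%N -> (nth 0 t j : R) = 0].

Lemma measurable_chart_cell d k : measurable (@chart_cell d k).
Proof.
elim: k => [|k IHk].
  rewrite (_ : chart_cell 0 = (fun t : T d => nth 0 t 0 : R) @^-1` `]0, 2 * pi[).
    rewrite -[X in measurable X]setTI; apply: measurable_nth_tuple => //.
  apply/seteqP; split => t /=; rewrite in_itv /=; first by case.
  by move=> h; split => // -[].
rewrite (_ : chart_cell k.+1 =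
    chart_cell k `&` (fun t : T d => nth 0 t k.+1 : R) @^-1` [set 0]).
  apply: measurableI => //.
  rewrite -[X in measurable X]setTI; apply: measurable_nth_tuple => //.
apply/seteqP; split => t /= [].
  move=> h0 h; split; last by apply: h; rewrite ltnSn.
  by split => // j /andP[j0 jk]; apply: h; rewrite j0 ltnW.
move=> [h0 h hk]; split => // j /andP[j0]; rewrite leq_eqVlt => /predU1P[-> //|jk].
by apply: h; rewrite j0 -ltnS.
Qed.

Lemma chart_cell_null d k : (0 < k)%N -> (1 < d)%N -> lt d (@chart_cell d k) = 0%E.
Proof.
move=> k0 d1; apply: (@subset_measure0 _ _ _ (lt d) _
    [set t : T d | tnth t (Ordinal d1) = 0]).
- exact: measurable_chart_cell.
- rewrite (_ : [set _ | _] = (fun t : T d => nth 0 t 1 : R) @^-1` [set 0]).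
    by rewrite -[X in measurable X]setTI; apply: measurable_nth_tuple.
  by apply/seteqP; split => t /=; rewrite (tnth_nth 0).
- by move=> t [_ /(_ 1%N k0)]; rewrite /= (tnth_nth 0).
- exact: lebesgue_tuple_coord0.
Qed.

(** The density of the pulled back form in any chart, without its constant factor. *)
Definition chart_density N d (t : T d) : R :=
  (2 - 2 * cos (nth 0 t 0)) ^+ N *
  (1 + \sum_(1 <= j < d) (nth 0 t j : R) ^+ 2) ^- N.+1.

Lemma chart_density_ge0 N d (t : T d) : 0 <= chart_density N t.
Proof.
apply: mulr_ge0; first by rewrite exprn_ge0 // subr_ge0 ger_pMr // cos_le1.
rewrite invr_ge0 exprn_ge0 // addr_ge0 // sumr_ge0 // => j _.
exact: sqr_ge0.
Qed.

Lemma measurable_chart_density N d :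
  measurable_fun [set: T d] (@chart_density N d : T d -> R).
Proof.
have mn j := @measurable_nth_tuple d j.
apply: measurable_funM.
  apply: measurable_funX; apply: measurable_funB => //.
  apply: measurable_funM => //.
  by apply: measurableT_comp (mn 0%N); exact: measurable_cos.
apply: measurable_fun_exprVn.
  apply: measurable_funD => //; apply: measurable_sum => j.
  by apply: measurable_funX.
move=> t; rewrite ltr_wpDr // sumr_ge0 // => j _; exact: sqr_ge0.
Qed.

Lemma integral_chart_density N d : d = N.*2.+1 ->
  (\int[lt d]_(t in chart_cell 0) (chart_density N t)%:E =
   (2 * pi * ((N.*2)`!%:R / N`!%:R ^+ 2) * (pi ^+ N / N`!%:R))%:E)%E.
Proof.
move=> ->.
have m0 : measurable (@chart_cell N.*2.+1 0) by exact: measurable_chart_cell.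
rewrite integral_mkcond ge0_integral_lebesgue_tupleS; last 2 first.
- apply/(measurable_restrictT _ m0); apply/measurable_EFinP.
  by apply: measurable_funTS; exact: measurable_chart_density.
- by move=> t; apply: erestrict_ge0 => {}t _; rewrite lee_fin chart_density_ge0.
pose w (x : R) := (((2 - 2 * cos x) ^+ N)%:E : \bar R).
have w0 x : (0 <= w x)%E.
  by rewrite lee_fin exprn_ge0 // subr_ge0 ger_pMr // cos_le1.
transitivity (\int[mu]_x ((w \_ `]0%R, (2 * pi)%R[) x *
    (pi ^+ N / N`!%:R)%:E))%E.
  apply: eq_integral => x _.
  rewrite -integral_inv_1sqnorm patchE; case: ifPn => xD; last first.
    rewrite mul0e integral0_eq // => u _; rewrite patchE ifF //.
    apply: contraNF xD; rewrite !inE /= in_itv /= => -[].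
    by rewrite /consp /=.
  rewrite -ge0_integralZl //; last 2 first.
  - apply/measurable_EFinP.
    apply: measurable_fun_exprVn.
      by apply: measurable_funD => //; exact: measurable_tuple_sqnorm.
    by move=> u; rewrite ltr_wpDr // tuple_sqnorm_ge0.
  - move=> u _; rewrite lee_fin invr_ge0 exprn_ge0 //.
    by rewrite addr_ge0 // tuple_sqnorm_ge0.
  apply: eq_integral => u _; rewrite patchE ifT; last first.
    rewrite inE; split; last by case.
    by move: xD; rewrite inE /= in_itv.
  rewrite -EFinM; congr EFin; rewrite /chart_density; congr (_ * _ ^- _).
  congr (1 + _); rewrite big_add1 /= big_mkord; apply: eq_bigr => i _.
  by rewrite (tnth_nth 0).
rewrite ge0_integralZr //; last 3 first.
- have mD : measurable (`]0%R, (2 * pi)%R[%classic : set R) by exact: measurable_itv.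
  apply/(measurable_restrictT _ mD); rewrite /w; apply/measurable_EFinP.
  apply: measurable_funTS; apply: measurable_funX; apply: measurable_funB => //.
  apply: measurable_funM => //; exact: measurable_cos.
- by move=> x _; apply: erestrict_ge0.
- by rewrite lee_fin divr_ge0 // exprn_ge0 // pi_ge0.
by rewrite -integral_mkcond integral_expr_2sub2cos -EFinM.
Qed.

End LebesgueTupleIntegrals.

(** * Parametrized matrices of class C1 *)

Section C1Calculus.
Variables (R : realType) (d : nat).
Local Notation C := R[i].

(** Unlike [C1_real], this names the partial derivatives, so that the rules below compute them while
    proving them continuous. *)
Definition C1_deriv (u : 'rV[R]_d -> R) (du : 'I_d -> 'rV[R]_d -> R) : Prop :=
  continuous u /\ forall j, continuous (du j) /\
    forall t : 'rV[R]_d, is_derive t (delta_mx 0 j) u (du j t).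

Lemma C1_deriv_cst (c : R) : C1_deriv (fun=> c) (fun _ _ => 0).
Proof.
split; first exact: cst_continuous.
move=> j; split; first exact: cst_continuous.
move=> t; exact: (@is_derive_cst _ _ _ c t (delta_mx 0 j)).
Qed.

Lemma C1_derivD u v du dv : C1_deriv u du -> C1_deriv v dv ->
  C1_deriv (fun t => u t + v t) (fun j t => du j t + dv j t).
Proof.
move=> [cu hu] [cv hv]; split; first by move=> t; exact: (continuousD (cu t) (cv t)).
move=> j; have [cdu Du] := hu j; have [cdv Dv] := hv j; split => t.
  exact: (continuousD (cdu t) (cdv t)).
exact: is_deriveD (Du t) (Dv t).
Qed.

Lemma C1_derivM u v du dv : C1_deriv u du -> C1_deriv v dv ->
  C1_deriv (fun t => u t * v t) (fun j t => du j t * v t + u t * dv j t).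
Proof.
move=> [cu hu] [cv hv]; split; first by move=> t; exact: (continuousM (cu t) (cv t)).
move=> j; have [cdu Du] := hu j; have [cdv Dv] := hv j; split => t.
  exact: (continuousD (continuousM (cdu t) (cv t)) (continuousM (cu t) (cdv t))).
apply: (is_derive_eq (is_deriveM (Du t) (Dv t))).
by rewrite /GRing.scale /= addrC mulrC.
Qed.

Lemma C1_derivN u du : C1_deriv u du ->
  C1_deriv (fun t => - u t) (fun j t => - du j t).
Proof.
move=> [cu hu]; split; first by move=> t; exact: (continuousN (cu t)).
move=> j; have [cdu Du] := hu j; split => t; first exact: (continuousN (cdu t)).
exact: is_deriveN (Du t).
Qed.

Lemma C1_derivV u du : (forall t, u t != 0) -> C1_deriv u du ->
  C1_deriv (fun t => (u t)^-1) (fun j t => - (u t) ^- 2 * du j t).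
Proof.
move=> u0 [cu hu]; split; first by move=> t; exact: (continuousV (u0 t) (cu t)).
move=> j; have [cdu Du] := hu j; split => t.
  apply: (continuousM _ (cdu t)); apply: continuousN.
  apply: continuousV; first by rewrite expf_neq0.
  exact: (continuous_comp (cu t) (@exprn_continuous _ 2 (u t))).
have [Du1 Du2] := Du t.
by split; [exact: derivableV|rewrite deriveV // Du2].
Qed.

(** Both derivatives have the same difference quotient; this gives access to the chain rule in one
    variable. *)
Lemma is_derive_line (u : 'rV[R]_d -> R) t v (c : R) :
  is_derive (0 : R) (1 : R) (fun h => u (h *: v + t)) c -> is_derive t v u c.
Proof.
have E : (fun h : R => h^-1 *: ((u \o shift t) (h *: v) - u t)) =
    (fun h => h^-1 *: (((fun h => u (h *: v + t)) \o shift (0 : R)) (h *: (1 : R)) -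
      (fun h => u (h *: v + t)) 0)).
  by apply/funext => h; rewrite /= scale0r add0r addr0 [h *: 1]mulr1.
by move=> [h1 h2]; split; [rewrite /derivable E|rewrite -h2 /derive E].
Qed.

Lemma coord_ord (t : 'rV[R]_d) (i : 'I_d) : coord t i = t 0 i.
Proof. by rewrite /coord valK. Qed.

Lemma continuous_coord k : continuous (fun t : 'rV[R]_d => coord t k).
Proof.
rewrite /coord; case: insubP => [i _ _|_] t; last exact: cst_continuous.
exact: coord_continuous.
Qed.

Lemma coordD (s t : 'rV[R]_d) k : coord (s + t) k = coord s k + coord t k.
Proof. by rewrite /coord; case: insubP => [i _ _|_]; rewrite ?mxE ?addr0. Qed.

Lemma coord_delta (h : R) (j : 'I_d) k :
  coord (h *: delta_mx 0 j) k = h * (k == j)%:R.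
Proof.
rewrite /coord; case: insubP => [i _ <-|kd]; first by rewrite !mxE eqxx.
by case: eqP kd => [->|]; rewrite ?ltn_ord ?mulr0.
Qed.

(** Along the basis vector [j] the coordinate [k] is affine with slope 1 or 0. *)
Lemma C1_deriv_comp_coord k (g dg : R -> R) :
  continuous dg -> (forall x : R, is_derive x 1 g (dg x)) ->
  C1_deriv (fun t => g (coord t k)) (fun j t => (k == j)%:R * dg (coord t k)).
Proof.
move=> cdg Dg.
have cg : continuous g.
  by move=> x; have [h _] := Dg x;
    apply/differentiable_continuous/derivable1_diffP.
split=> [t|j].
  exact: (continuous_comp (@continuous_coord k t) (cg _)).
split=> t.
  exact: (continuousM (@cst_continuous _ _ ((k == j)%:R : R) t)
    (continuous_comp (@continuous_coord k t) (cdg _))).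
apply: is_derive_line.
rewrite (_ : (fun _ => _) = g \o (fun h : R => h * (k == j)%:R + coord t k)).
  have Dl : is_derive (0 : R) (1 : R)
      (fun h : R => h * (k == j)%:R + coord t k) (k == j)%:R.
    have := is_deriveD (is_deriveM (is_derive_id (0 : R) (1 : R))
      (is_derive_cst ((k == j)%:R : R) (0 : R) (1 : R)))
      (is_derive_cst (coord t k) (0 : R) (1 : R)).
    by move/is_derive_eq; apply; rewrite /GRing.scale /= /cst; ring.
  have Dg' : is_derive (0 * (k == j)%:R + coord t k : R) (1 : R) g (dg (coord t k)).
    by rewrite mul0r add0r; exact: Dg.
  have Dgl := @is_derive1_comp _ g
    (fun h : R => h * (k == j)%:R + coord t k) 0 _ _ Dg' Dl.
  by apply: (is_derive_eq Dgl); rewrite mulrC.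
by apply/funext => h; rewrite /= coordD coord_delta.
Qed.

Lemma C1_deriv_coord k :
  C1_deriv (fun t => coord t k) (fun j _ => (k == j)%:R).
Proof.
have c1 : continuous (fun _ : R => 1 : R) by exact: cst_continuous.
have := C1_deriv_comp_coord k c1 (fun x : R => is_derive_id x (1 : R)).
congr C1_deriv; apply/funext => j; apply/funext => t; exact: mulr1.
Qed.

Definition C1_cderiv (F : 'rV[R]_d -> C) (dF : 'I_d -> 'rV[R]_d -> C) : Prop :=
  C1_deriv (fun t => complex.Re (F t)) (fun j t => complex.Re (dF j t)) /\
  C1_deriv (fun t => complex.Im (F t)) (fun j t => complex.Im (dF j t)).

Lemma C1_cderiv_eq F dF dF' : C1_cderiv F dF -> (forall j t, dF j t = dF' j t) ->
  C1_cderiv F dF'.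
Proof.
move=> h dFE; rewrite (_ : dF' = dF) //.
by apply/funext => j; apply/funext => t; rewrite dFE.
Qed.

Lemma C1_cderiv_cst (c : C) : C1_cderiv (fun=> c) (fun _ _ => 0).
Proof. by split; exact: C1_deriv_cst. Qed.

Lemma C1_cderivD F G dF dG : C1_cderiv F dF -> C1_cderiv G dG ->
  C1_cderiv (fun t => F t + G t) (fun j t => dF j t + dG j t).
Proof.
move=> [F1 F2] [G1 G2]; split.
  have := C1_derivD F1 G1; congr C1_deriv.
    by apply/funext => t; case: (F t) (G t) => ? ? [].
  by apply/funext => j; apply/funext => t; case: (dF j t) (dG j t) => ? ? [].
have := C1_derivD F2 G2; congr C1_deriv.
  by apply/funext => t; case: (F t) (G t) => ? ? [].
by apply/funext => j; apply/funext => t; case: (dF j t) (dG j t) => ? ? [].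
Qed.

Lemma C1_cderivN F dF : C1_cderiv F dF ->
  C1_cderiv (fun t => - F t) (fun j t => - dF j t).
Proof.
move=> [F1 F2]; split.
  have := C1_derivN F1; congr C1_deriv.
    by apply/funext => t; case: (F t).
  by apply/funext => j; apply/funext => t; case: (dF j t).
have := C1_derivN F2; congr C1_deriv.
  by apply/funext => t; case: (F t).
by apply/funext => j; apply/funext => t; case: (dF j t).
Qed.

Lemma C1_cderivM F G dF dG : C1_cderiv F dF -> C1_cderiv G dG ->
  C1_cderiv (fun t => F t * G t) (fun j t => dF j t * G t + F t * dG j t).
Proof.
move=> [F1 F2] [G1 G2]; split.
  have := C1_derivD (C1_derivM F1 G1) (C1_derivN (C1_derivM F2 G2)).
  congr C1_deriv.
    by apply/funext => t; case: (F t) (G t) => ? ? [].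
  apply/funext => j; apply/funext => t.
  by case: (F t) (G t) (dF j t) (dG j t) => ? ? [? ?] [? ?] [? ?] /=; ring.
have := C1_derivD (C1_derivM F1 G2) (C1_derivM F2 G1).
congr C1_deriv.
  by apply/funext => t; case: (F t) (G t) => ? ? [].
apply/funext => j; apply/funext => t.
by case: (F t) (G t) (dF j t) (dG j t) => ? ? [? ?] [? ?] [? ?] /=; ring.
Qed.

Lemma C1_cderiv_conj F dF : C1_cderiv F dF ->
  C1_cderiv (fun t => (F t)^*) (fun j t => (dF j t)^*).
Proof.
move=> [F1 F2]; split.
  have := F1; congr C1_deriv; first by apply/funext => t; case: (F t).
  by apply/funext => j; apply/funext => t; case: (dF j t).
have := C1_derivN F2; congr C1_deriv; first by apply/funext => t; case: (F t).
by apply/funext => j; apply/funext => t; case: (dF j t).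
Qed.

(** The inverse is the conjugate of [F] divided by the real function |F|^2, so the real rule
    suffices. *)
Lemma C1_cderivV F dF : (forall t, F t != 0) -> C1_cderiv F dF ->
  C1_cderiv (fun t => (F t)^-1) (fun j t => - (F t) ^- 2 * dF j t).
Proof.
move=> F0 FdF; have [F1 F2] := FdF.
pose q t : R := complex.Re (F t) * complex.Re (F t) +
                complex.Im (F t) * complex.Im (F t).
have qE t : ((q t)%:C)%C = F t * (F t)^*.
  by rewrite /q; case: (F t) => a b; apply/eqP; rewrite eq_complex /=;
    apply/andP; split; apply/eqP; ring.
have qVE t : (((q t)^-1)%:C)%C = (F t * (F t)^*)^-1.
  by rewrite -qE; apply: fmorphV.
have q0 t : q t != 0.
  have : ((q t)%:C)%C != 0 by rewrite qE mulf_neq0 // conjC_eq0.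
  by apply: contra_neq => ->.
have qd := C1_derivV q0 (C1_derivD (C1_derivM F1 F1) (C1_derivM F2 F2)).
have qV : C1_cderiv (fun t => (((q t)^-1)%:C)%C) (fun j t =>
    - (F t * (F t)^*) ^- 2 * (dF j t * (F t)^* + F t * (dF j t)^*)).
  split; last first.
    have := C1_deriv_cst (0 : R); congr C1_deriv.
    apply/funext => j; apply/funext => t; rewrite -qE -rmorphXn -fmorphV.
    by case: (F t) (dF j t) => a b [c e] /=; ring.
  have := qd; congr C1_deriv.
  apply/funext => j; apply/funext => t; rewrite -qE -rmorphXn -fmorphV.
  by case: (F t) (dF j t) => a b [c e] /=; ring.
have := C1_cderivM (C1_cderiv_conj FdF) qV; congr C1_cderiv.
  apply/funext => t; rewrite qVE; have := F0 t.
  by rewrite -conjC_eq0 => Fc0; field; rewrite Fc0 F0.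
apply/funext => j; apply/funext => t; rewrite qVE; have := F0 t.
by rewrite -conjC_eq0 => Fc0; field; rewrite Fc0 F0.
Qed.

End C1Calculus.

Section C1Matrix.
Local Open Scope sesquilinear_scope.
Variables (R : realType) (d : nat).
Local Notation C := R[i].

Lemma C1_cderiv_sum (I : finType) (F : I -> 'rV[R]_d -> C) dF :
  (forall i, C1_cderiv (F i) (dF i)) ->
  C1_cderiv (fun t => \sum_i F i t) (fun j t => \sum_i dF i j t).
Proof.
move=> h; elim: (index_enum I) => [|i s IHs].
  have := @C1_cderiv_cst R d 0; congr C1_cderiv.
    by apply/funext => t; rewrite big_nil.
  by apply/funext => j; apply/funext => t; rewrite big_nil.
have := C1_cderivD (h i) IHs; congr C1_cderiv.
  by apply/funext => t; rewrite big_cons.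
by apply/funext => j; apply/funext => t; rewrite big_cons.
Qed.

Definition C1_mderiv n p (f : 'rV[R]_d -> 'M[C]_(n, p))
    (df : 'I_d -> 'rV[R]_d -> 'M[C]_(n, p)) : Prop :=
  forall a b, C1_cderiv (fun t => f t a b) (fun j t => df j t a b).

Lemma C1_mderiv_cst n p (A : 'M[C]_(n, p)) : C1_mderiv (fun=> A) (fun _ _ => 0).
Proof.
move=> a b; have := @C1_cderiv_cst R d (A a b); congr C1_cderiv.
by apply/funext => j; apply/funext => t; rewrite mxE.
Qed.

Lemma C1_mderivD n p (f g : 'rV[R]_d -> 'M[C]_(n, p)) df dg :
  C1_mderiv f df -> C1_mderiv g dg ->
  C1_mderiv (fun t => f t + g t) (fun j t => df j t + dg j t).
Proof.
move=> hf hg a b; have := C1_cderivD (hf a b) (hg a b); congr C1_cderiv.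
  by apply/funext => t; rewrite mxE.
by apply/funext => j; apply/funext => t; rewrite mxE.
Qed.

Lemma C1_mderivN n p (f : 'rV[R]_d -> 'M[C]_(n, p)) df :
  C1_mderiv f df -> C1_mderiv (fun t => - f t) (fun j t => - df j t).
Proof.
move=> hf a b; have := C1_cderivN (hf a b); congr C1_cderiv.
  by apply/funext => t; rewrite mxE.
by apply/funext => j; apply/funext => t; rewrite mxE.
Qed.

Lemma C1_mderivZ n p (F : 'rV[R]_d -> C) dF (f : 'rV[R]_d -> 'M[C]_(n, p)) df :
  C1_cderiv F dF -> C1_mderiv f df ->
  C1_mderiv (fun t => F t *: f t) (fun j t => dF j t *: f t + F t *: df j t).
Proof.
move=> hF hf a b; have := C1_cderivM hF (hf a b); congr C1_cderiv.
  by apply/funext => t; rewrite mxE.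
by apply/funext => j; apply/funext => t; rewrite !mxE.
Qed.

Lemma C1_mderivM n p q (f : 'rV[R]_d -> 'M[C]_(n, p)) df
    (g : 'rV[R]_d -> 'M[C]_(p, q)) dg :
  C1_mderiv f df -> C1_mderiv g dg ->
  C1_mderiv (fun t => f t *m g t) (fun j t => df j t *m g t + f t *m dg j t).
Proof.
move=> hf hg a b.
have := C1_cderiv_sum (fun k => C1_cderivM (hf a k) (hg k b)).
congr C1_cderiv; first by apply/funext => t; rewrite mxE.
by apply/funext => j; apply/funext => t; rewrite !mxE -big_split.
Qed.

Lemma C1_mderiv_ctr n p (f : 'rV[R]_d -> 'M[C]_(n, p)) df :
  C1_mderiv f df -> C1_mderiv (fun t => (f t) ^t*) (fun j t => (df j t) ^t*).
Proof.
move=> hf a b; have := C1_cderiv_conj (hf b a); congr C1_cderiv.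
  by apply/funext => t; rewrite !mxE.
by apply/funext => j; apply/funext => t; rewrite !mxE.
Qed.

Lemma partial_C1_mderiv n (f : 'rV[R]_d -> 'M[C]_n) df t j :
  C1_mderiv f df -> partial f t j = df j t.
Proof.
move=> hf; apply/matrixP => a b; rewrite mxE.
have [[_ /(_ j)[_ /(_ t)[_ ->]]] [_ /(_ j)[_ /(_ t)[_ ->]]]] := hf a b.
by case: (df j t a b).
Qed.

Lemma C1_of_C1_mderiv n W (f : 'rV[R]_d -> 'M[C]_n) df :
  C1_mderiv f df -> C1 W f.
Proof.
have H (u : 'rV[R]_d -> R) du : C1_deriv u du -> C1_real W u.
  move=> [cu hu] j t _; have [cdu Du] := hu j; split; first by have [] := Du t.
  rewrite (_ : 'D_(delta_mx 0 j) u = du j); first exact: cdu.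
  by apply/funext => s; have [_ ->] := Du s.
by move=> hf a b; have [/H h1 /H h2] := hf a b.
Qed.

End C1Matrix.

(** * The pullback of the form by phi *)

Section PhiParam.
Local Open Scope sesquilinear_scope.
Variables (R : realType) (n : nat).
Local Notation C := R[i].
Local Notation dim := (2 * n).-1%N.

Definition circle_coord d (t : 'rV[R]_d) : C :=
  Complex (cos (coord t 0)) (sin (coord t 0)).

Definition chart_coord d (t : 'rV[R]_d) (j : nat) : C :=
  Complex (coord t j.*2.+1) (coord t j.*2.+2).

Local Notation pvec k t := (affine_point k (chart_coord t)).

(** The value of dz_j on the coordinate field [p]: 1 for x_j, i for y_j, 0 otherwise. *)
Definition dchart_coord (j p : nat) : C :=
  Complex (j.*2.+1 == p)%:R (j.*2.+2 == p)%:R.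

Definition chart_tangent (k : 'I_n) (p : nat) : 'cV[C]_n :=
  \col_i (if i == k then 0 else dchart_coord (unbump k i) p).

Lemma phi_paramE (k : 'I_n) (t : 'rV[R]_dim) :
  phi_param k t = rotation (circle_coord t) (pvec k t) ((pvec k t) ^t*).
Proof. by []. Qed.

Lemma ctr_mul_self_affine_point (k : 'I_n) d (t : 'rV[R]_d) :
  d = dim ->
  ((pvec k t) ^t* *m pvec k t) 0 0 = ((1 + \sum_(1 <= j < d) coord t j ^+ 2)%:C)%C.
Proof.
case: n k => [|N] k dE; first by have := ltn_ord k.
rewrite mxE (bigD1_ord k) //= rmorphD rmorph_sum /=; congr (_ + _).
  by rewrite !mxE eqxx conjC1 mul1r.
transitivity (\sum_(0 <= i < N) ((coord t i.*2.+1 ^+ 2 + coord t i.*2.+2 ^+ 2)%:C)%C).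
  rewrite big_mkord; apply: eq_bigr => i _; rewrite !mxE.
  rewrite eq_sym (negbTE (neq_lift _ _)) /= bumpK /chart_coord.
  by apply/eqP; rewrite eq_complex /=; apply/andP; split; apply/eqP; ring.
move: (coord t) => f; rewrite dE mul2n doubleS /= big_add1 /= -addnn.
clear; elim: N => [|N IHN]; first by rewrite !big_geq.
rewrite big_nat_recr //= IHN addnS addSn !big_nat_recr //= -addrA rmorphD.
by rewrite addnn.
Qed.

Lemma ctr_mul_self_affine_point_neq0 (k : 'I_n) (t : 'rV[R]_dim) :
  ((pvec k t) ^t* *m pvec k t) 0 0 != 0.
Proof.
rewrite ctr_mul_self_affine_point // (inj_eq (@complexI R) _ 0).
by rewrite gt_eqF // ltr_wpDr // sumr_ge0 // => j _; exact: sqr_ge0.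
Qed.

Lemma C1_cderiv_circle_coord :
  C1_cderiv (@circle_coord dim) (fun p t =>
    (0%N == p)%:R * (Complex 0 1 * circle_coord t)).
Proof.
split.
  have := @C1_deriv_comp_coord R dim 0 cos (fun x => - sin x)
    (fun x => continuousN (@continuous_sin R x)) (fun x => is_derive_cos x).
  congr C1_deriv; apply/funext => p; apply/funext => t /=.
  by case: eqP => _; rewrite ?mul0r ?mul1r //=; ring.
have := @C1_deriv_comp_coord R dim 0 sin cos
  (@continuous_cos R) (fun x => is_derive_sin x).
congr C1_deriv; apply/funext => p; apply/funext => t /=.
by case: eqP => _; rewrite ?mul0r ?mul1r //=; ring.
Qed.

Lemma C1_mderiv_affine_point (k : 'I_n) :
  C1_mderiv (fun t : 'rV[R]_dim => affine_point k (chart_coord t))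
    (fun p _ => chart_tangent k p).
Proof.
move=> a b; have [ak|ak] := eqVneq a k.
  have := @C1_cderiv_cst R dim 1; congr C1_cderiv.
    by apply/funext => t; rewrite mxE ak eqxx.
  by apply/funext => p; apply/funext => t; rewrite mxE ak eqxx.
have : C1_cderiv (fun t : 'rV[R]_dim => chart_coord t (unbump k a))
    (fun p _ => dchart_coord (unbump k a) p).
  by split; exact: C1_deriv_coord.
congr C1_cderiv; first by apply/funext => t; rewrite mxE (negbTE ak).
by apply/funext => p; apply/funext => t; rewrite mxE (negbTE ak).
Qed.

Lemma C1_mderiv_phi_param (k : 'I_n) :
  C1_mderiv (@phi_param R n k) (fun p t =>
    ((0%N == p)%:R * (Complex 0 1 * circle_coord t)) *:
      rank1_proj (pvec k t) ((pvec k t) ^t*) +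
    (circle_coord t - 1) *:
      drank1_proj (pvec k t) ((pvec k t) ^t*)
        (chart_tangent k p) ((chart_tangent k p) ^t*)).
Proof.
have dv := C1_mderiv_affine_point k.
have dv' := C1_mderiv_ctr dv.
have dc := C1_cderivV (@ctr_mul_self_affine_point_neq0 k) (C1_mderivM dv' dv 0 0).
have dP := C1_mderivZ dc (C1_mderivM dv dv').
have d1 := @C1_mderiv_cst R dim _ _ (1%:M : 'M[C]_n).
have := C1_mderivD (C1_mderivZ C1_cderiv_circle_coord dP)
  (C1_mderivD d1 (C1_mderivN dP)).
rewrite /C1_mderiv => h a b; apply: (C1_cderiv_eq (h a b)) => p t.
(* The rules give dl P + (l dP - dP), and the last two terms combine to (l - 1) dP. *)
congr (fun_of_matrix _ a b); rewrite add0r -addrA; congr (_ + _).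
by rewrite -[RHS]/((_ - _) *: _) scalerBl scale1r.
Qed.

End PhiParam.

Section Pullback.
Local Open Scope sesquilinear_scope.
Variables (R : realType) (N : nat).
Local Notation C := R[i].
Local Notation dim := (2 * N.+1).-1%N.
Local Notation pvec k t := (affine_point k (chart_coord t)).

Lemma circle_coord_mul_conj d (t : 'rV[R]_d) :
  circle_coord t * (circle_coord t)^* = 1.
Proof.
apply/eqP; rewrite eq_complex /=; apply/andP; split; apply/eqP; last by ring.
by rewrite -(cos2Dsin2 (coord t 0)); ring.
Qed.

Lemma circle_coord_neq0 d (t : 'rV[R]_d) : circle_coord t != 0.
Proof.
apply/eqP => h; have := circle_coord_mul_conj t.
by rewrite h mul0r => /eqP; rewrite eq_sym oner_eq0.
Qed.

(** As [l^-1] is the conjugate of [l], the product is l + conj(l) - 2 = - |l - 1|^2. *)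
Lemma circle_coord_sub1M d (t : 'rV[R]_d) :
  (circle_coord t - 1) * (1 - (circle_coord t)^-1) =
  - ((2 - 2 * cos (coord t 0))%:C)%C.
Proof.
have -> : (circle_coord t)^-1 = (circle_coord t)^*.
  apply: (mulfI (circle_coord_neq0 t)).
  by rewrite mulfV ?circle_coord_neq0 // circle_coord_mul_conj.
apply/eqP; rewrite eq_complex /=; apply/andP; split; apply/eqP; last by ring.
have := cos2Dsin2 (coord t 0); set c := cos _; set s := sin _ => cs.
transitivity (2 * c - 1 - (c ^+ 2 + s ^+ 2)); first by ring.
by rewrite cs; ring.
Qed.

Lemma chart_tangent_mulmx (k : 'I_N.+1) p (a : 'rV[C]_N.+1) :
  (a *m chart_tangent R k p) 0 0 =
  \sum_(l < N) a 0 (lift k l) * dchart_coord R l p.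
Proof.
rewrite mxE (bigD1_ord k) //= mxE eqxx mulr0 add0r.
apply: eq_bigr => l _; rewrite mxE eq_sym (negbTE (neq_lift _ _)) bumpK.
by [].
Qed.

Lemma ctr_chart_tangent_mulmx (k : 'I_N.+1) p (a : 'cV[C]_N.+1) :
  ((chart_tangent R k p) ^t* *m a) 0 0 =
  \sum_(l < N) (dchart_coord R l p)^* * a (lift k l) 0.
Proof.
rewrite mxE (bigD1_ord k) //= !mxE eqxx conjC0 mul0r add0r.
apply: eq_bigr => l _; rewrite !mxE eq_sym (negbTE (neq_lift _ _)) bumpK.
by [].
Qed.

(** The hermitian form on the orthogonal parts of tangent vectors, in the coordinates dz_j; divided
    by c = v^* v it is the Fubini-Study metric. *)
Definition chart_metric (k : 'I_N.+1) (t : 'rV[R]_dim) : 'M[C]_N :=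
  1%:M - (\col_j pvec k t (lift k j) 0) *m
    ((((pvec k t) ^t* *m pvec k t) 0 0)^-1 *:
      (\row_l ((pvec k t) ^t*) 0 (lift k l))).

(** The rank one update gives 1 - |z|^2 / c, where |z|^2 = c - 1. *)
Lemma det_chart_metric k t :
  \det (chart_metric k t) = (((pvec k t) ^t* *m pvec k t) 0 0)^-1.
Proof.
have c0 := ctr_mul_self_affine_point_neq0 k t; rewrite /chart_metric det_sub_rank1.
rewrite -scalemxAl mxE.
have -> : ((\row_l ((pvec k t) ^t*) 0 (lift k l)) *m
    (\col_j pvec k t (lift k j) 0)) 0 0 = ((pvec k t) ^t* *m pvec k t) 0 0 - 1.
  rewrite [X in _ = X - 1]mxE (bigD1_ord k) //= !mxE eqxx conjC1 mul1r.
  rewrite addrAC subrr add0r.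
  by apply: eq_bigr => l _; rewrite !mxE.
by move: (_ 0 0) c0 => c c0; field.
Qed.

Lemma orth_chart_tangent_mul k t p q :
  (orth_row (pvec k t) ((pvec k t) ^t*) ((chart_tangent R k p) ^t*) *m
   orth_part (pvec k t) ((pvec k t) ^t*) (chart_tangent R k q)) 0 0 =
  \sum_(j < N) (dchart_coord R j p)^* *
    \sum_(l < N) chart_metric k t j l * dchart_coord R l q.
Proof.
rewrite orth_row_mul_orth_part ?ctr_mul_self_affine_point_neq0 //.
rewrite (chart_tangent_mulmx k q ((pvec k t) ^t*)).
rewrite (ctr_chart_tangent_mulmx k p (chart_tangent R k q)).
rewrite (ctr_chart_tangent_mulmx k p (pvec k t)).
have E j : \sum_(l < N) chart_metric k t j l * dchart_coord R l q =
    chart_tangent R k q (lift k j) 0 - pvec k t (lift k j) 0 *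
      ((((pvec k t) ^t* *m pvec k t) 0 0)^-1 *
       \sum_(l < N) ((pvec k t) ^t*) 0 (lift k l) * dchart_coord R l q).
  rewrite /chart_metric; move: (((pvec k t) ^t* *m pvec k t) 0 0) => c.
  rewrite !mulr_sumr (bigD1 j) //= [X in _ = X - _]mxE eq_sym.
  rewrite (negbTE (neq_lift _ _)) bumpK (bigD1 j (F := fun l => _ * (_ * _))) //=.
  rewrite opprD addrA -sumrN; congr (_ + _).
    rewrite !mxE big_ord1 !mxE eqxx; move: (if _ then _ else _) => a.
    by rewrite mulrBl mul1r !mulrA.
  apply: eq_bigr => l lj; rewrite !mxE big_ord1 !mxE [j == l]eq_sym (negbTE lj).
  by rewrite sub0r mulNr !mulrA.
rewrite [RHS](eq_bigr (fun j : 'I_N =>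
  (dchart_coord R j p)^* * chart_tangent R k q (lift k j) 0 -
  (dchart_coord R j p)^* * pvec k t (lift k j) 0 *
      ((((pvec k t) ^t* *m pvec k t) 0 0)^-1 *
       \sum_(l < N) ((pvec k t) ^t*) 0 (lift k l) * dchart_coord R l q))); last first.
  by move=> j _; rewrite E mulrBr !mulrA.
rewrite sumrB; congr (_ - _); rewrite -mulr_suml mulrA; congr (_ * _).
by rewrite mulrC.
Qed.

Lemma dchart_coord_odd j l : dchart_coord R j l.*2.+1 = (j == l)%:R.
Proof.
rewrite /dchart_coord !eqSS (inj_eq double_inj) (_ : (_ == l.*2) = false).
  by case: (j == l).
by apply/eqP => /(congr1 odd); rewrite /= !odd_double.
Qed.

Lemma dchart_coord_even j l :
  dchart_coord R j l.*2.+2 = Complex 0 1 * (j == l)%:R.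
Proof.
rewrite /dchart_coord !eqSS (inj_eq double_inj) (_ : (_ == l.*2.+1) = false).
  by case: (j == l); rewrite ?mulr1 ?mulr0.
by apply/eqP => /(congr1 odd); rewrite /= !odd_double.
Qed.

Definition pullback_constant : R :=
  2 ^+ N * N`!%:R ^+ 3 / ((2 * pi) ^+ N.+1 * (N.*2)`!%:R).

Lemma c_form_phi_param (k : 'I_N.+1) (t : 'rV[R]_dim) :
  c_form (phi_param k t) (partial (phi_param k) t) =
  ((pullback_constant * ((2 - 2 * cos (coord t 0)) ^+ N *
    (1 + \sum_(1 <= j < dim) coord t j ^+ 2) ^- N.+1))%:C)%C.
Proof.
have dimE : dim = N.*2.+1 by rewrite mul2n doubleS.
set v := pvec k t; set v' := v ^t*.
have c0 : (v' *m v) 0 0 != 0 := ctr_mul_self_affine_point_neq0 k t.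
have l0 := circle_coord_neq0 t.
pose w p := invmx (phi_param k t) *m partial (phi_param k) t p.
pose c := (v' *m v) 0 0.
have T : \tr (wedge_power (@maurer_cartan R N.+1) (phi_param k t)
    (partial (phi_param k) t)) =
  dim%:R * (Complex 0 1 / c * c * ((circle_coord t - 1) / c *
    ((1 - (circle_coord t)^-1) / c) * c) ^+ N) *
  (N`!%:R * ((2 * Complex 0 1) ^+ N * \det (chart_metric k t))).
  rewrite /wedge_power linear_sum /=.
  transitivity (\sum_(g : 'S_dim) (-1) ^+ g * \tr (\prod_(i < dim) w (g i))).
    by apply: eq_bigr => g _; rewrite linearZ.
  apply: (@wedge_rank1_pairs_dim _ N dim w _ _ _ _ (Complex 0 1) v v'
    (fun p => orth_part v v' (chart_tangent R k p))
    (fun p => orth_row v v' ((chart_tangent R k p) ^t*))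
    (fun l p => dchart_coord R l p) (fun l p => (dchart_coord R l p)^*)
    (chart_metric k t) dimE).
  - exact: mulmx_rv_cv.
  - by move=> p; exact: mulmx_orth_part.
  - by move=> p; exact: mulmx_orth_row.
  - move=> p p0; rewrite /w (partial_C1_mderiv _ _ (@C1_mderiv_phi_param R _ k)).
    (* No z_j depends on coordinate 0: theta does not move the line. *)
    have -> : chart_tangent R k p = 0.
      apply/matrixP => i j; rewrite !mxE p0; case: ifP => //.
    rewrite p0 eqxx mul1r.
    have -> : drank1_proj v v' 0 (0 ^t*) = 0.
      by rewrite /drank1_proj trmx0 map_mx0 !(mul0mx, mulmx0) !addr0
        [X in _ * X]mxE mulr0 !(scale0r, scaler0) addr0.
    rewrite scaler0 addr0.
    rewrite (invmx_rotation_mul_proj (Complex 0 1) c0 l0) //.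
  - move=> p p0; rewrite /w (partial_C1_mderiv _ _ (@C1_mderiv_phi_param R _ k)).
    rewrite eq_sym (negbTE p0) mul0r scale0r add0r.
    exact: (invmx_rotation_mul_drotation (chart_tangent R k p)
      ((chart_tangent R k p) ^t*) c0 l0).
  - by move=> p q; exact: orth_chart_tangent_mul.
  - by [].
  - by move=> j; rewrite conjC0.
  - by move=> j l /=; rewrite dchart_coord_odd conjC_nat.
  - move=> j l /=; rewrite dchart_coord_even rmorphM /= conjC_nat; split => //.
    by congr (_ * _); apply/eqP; rewrite eq_complex /= oppr0 !eqxx.
have cE : c = ((1 + \sum_(1 <= j < dim) coord t j ^+ 2)%:C)%C.
  exact: ctr_mul_self_affine_point.
rewrite /c_form T {T w} det_chart_metric -/v -/v' -/c.
have -> : (circle_coord t - 1) / c * ((1 - (circle_coord t)^-1) / c) * c =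
    (circle_coord t - 1) * (1 - (circle_coord t)^-1) / c.
  by field; rewrite c0 l0.
have RE (q b : R) : ((pullback_constant * (q ^+ N * b ^- N.+1))%:C)%C =
    2 ^+ N * N`!%:R ^+ 3 / (((2 * pi)%:C)%C ^+ N.+1 * (N.*2)`!%:R) *
    ((q%:C)%C ^+ N * (b%:C)%C ^- N.+1).
  by rewrite !(rmorphM, fmorphV, rmorphXn, rmorph_nat).
rewrite circle_coord_sub1M RE -cE -complexiE.
have {}c0 : c != 0 by []; clear cE RE l0; move: c c0; clear v v' => c c0.
have : ((2 * pi)%:C)%C != 0 :> C.
  by rewrite (inj_eq (@complexI R) _ 0) mulf_neq0 // gt_eqF // pi_gt0.
move: ((2 * pi)%:C)%C (((2 - 2 * cos (coord t 0))%:C)%C) => p m p0 {k t}.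
have : Complex 0 1 * Complex 0 1 = -1 :> C by rewrite -expr2 sqr_i.
move: (Complex 0 1) => I I2.
rewrite dimE factS natrM.
have f1 : N.*2.+1%:R != 0 :> C by rewrite pnatr_eq0.
have f2 : (N.*2)`!%:R != 0 :> C by rewrite pnatr_eq0 -lt0n fact_gt0.
move: (N.*2.+1%:R) ((N.*2)`!%:R) f1 f2 => a b a0 b0.
have e2 : (-1) ^+ N * (-1) ^+ N = 1 :> C by rewrite -expr2 sqrr_sign.
have IN2 : I ^+ N * I ^+ N = (-1) ^+ N by rewrite -exprMn I2.
have -> : (- m / c) ^+ N = (-1) ^+ N * m ^+ N / c ^+ N.
  by rewrite -[- m]mulN1r !exprMn exprVn.
have -> : (I / p) ^+ N.+1 = I * I ^+ N / (p * p ^+ N).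
  by rewrite exprMn exprVn !exprS.
rewrite [(2 * I) ^+ N]exprMn natrX [c ^+ N.+1]exprS [p ^+ N.+1]exprS !expr2.
rewrite [_ ^+ 3]exprS expr2.
(* Powers with exponent [N] become atoms, leaving a rational identity with the relations [I2], [J2]
   and [e2]. *)
move: (I ^+ N) ((-1) ^+ N) IN2 e2 => J e J2 e2.
have pN0 : p ^+ N != 0 by rewrite expf_neq0.
have cN0 : c ^+ N != 0 by rewrite expf_neq0.
move: (p ^+ N) (c ^+ N) (m ^+ N) (2 ^+ N) (N`!%:R) pN0 cN0 =>
  pN cN mN tN f pN0 cN0.
(* All signs are gathered in front: - i^2 = 1, and (i^N)^2 = (-1)^N cancels the sign of (- m)^N. *)
transitivity (- (I * I) * (J * J) * e *
  (tN * (f * (f * f)) / (p * pN * b) * (mN / (c * cN)))).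
  by field; rewrite a0 b0 c0 p0 pN0 cN0.
by rewrite I2 J2 opprK mul1r e2 mul1r.
Qed.

End Pullback.

(** * The charts of the stratum *)

Section CircleAngle.
Variable R : realType.

Lemma cos_lt1 (x : R) : 0 < x < 2 * pi -> cos x < 1.
Proof.
move=> /andP[x0 xpi]; have s0 : 0 < sin (x / 2).
  apply: sin_gt0_pi; rewrite divr_gt0 //=.
  by rewrite ltr_pdivrMr // mulrC.
have -> : x = (x / 2) *+ 2 by rewrite -mulr_natr divfK.
rewrite cos_mulr2n cos2sin2 -mulr_natr mulrBl mul1r.
have := exprn_gt0 2 s0; lra.
Qed.

(** Equal sines and cosines force cos (b - a) = 1, which is excluded for 0 < b - a < 2 pi. *)
Lemma cos_sin_inj (a b : R) : 0 < a < 2 * pi -> 0 < b < 2 * pi ->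
  cos a = cos b -> sin a = sin b -> a = b.
Proof.
wlog ab : a b / a <= b.
  move=> h ha hb ec es; have [/h|/ltW/h h'] := leP a b; first exact.
  by symmetry; exact: h'.
move=> /andP[a0 _] /andP[_ bpi] ec es; apply/eqP; rewrite eq_le ab /= leNgt.
apply/negP => ltab; have : cos (b - a) < 1.
  apply: cos_lt1; rewrite subr_gt0 ltab /=.
  by apply: lt_trans bpi; rewrite ltrBlDr ltrDl.
by rewrite cosB ec es -!expr2 cos2Dsin2 ltxx.
Qed.

(** [acos] covers the upper half circle and its reflection 2 pi - [acos] the lower one; omitting the
    point 1 keeps the angle in the open interval. *)
Lemma exists_angle (x y : R) : x ^+ 2 + y ^+ 2 = 1 -> ~ (x = 1 /\ y = 0) ->
  exists2 a : R, 0 < a < 2 * pi & cos a = x /\ sin a = y.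
Proof.
move=> xy1 xyN1.
have x2 : x ^+ 2 <= 1 by rewrite -xy1 lerDl sqr_ge0.
have xI : -1 <= x <= 1.
  by rewrite -ler_norml -(expr_le1 (n := 2)) // real_normK ?num_real.
have [/andP[a0 api] ca] := acos_def xI.
have sa0 : 0 <= sin (acos x) by apply: sin_ge0_pi; rewrite a0.
have sa2 : sin (acos x) ^+ 2 = y ^+ 2 by rewrite sin2cos2 ca -xy1 addrC addKr.
have [y0|y0] := leP 0 y.
  exists (acos x); last first.
    split => //; apply/eqP; rewrite -(@eqrXn2 _ 2) //; exact/eqP.
  rewrite lt_neqAle a0 andbT; apply/andP; split; last first.
    by apply: le_lt_trans api _; rewrite ltr_pMl ?pi_gt0 // ltr1n.
  apply/eqP => aE; apply: xyN1; move: ca sa2; rewrite -aE cos0 sin0 => <-.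
  by rewrite expr0n /= => /esym/eqP; rewrite sqrf_eq0 => /eqP.
have aN : 0 < acos x.
  rewrite lt_neqAle a0 andbT; apply/eqP => aE; move: sa2.
  rewrite -aE sin0 expr0n /= => /esym/eqP; rewrite sqrf_eq0 => /eqP yE.
  by rewrite yE ltxx in y0.
exists (2 * pi - acos x).
  rewrite subr_gt0 ltrBlDr ltrDl aN andbT.
  by apply: le_lt_trans api _; rewrite ltr_pMl ?pi_gt0 // ltr1n.
rewrite mulr_natl cosB sinB cos2pi sin2pi !mul1r !mul0r addr0 sub0r ca; split => //.
apply/eqP; rewrite -eqr_opp opprK -(@eqrXn2 _ 2) ?sqrrN ?oppr_ge0 ?(ltW y0) //.
exact/eqP.
Qed.

End CircleAngle.

(** * Unitary matrices that differ from 1 by rank one *)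

Section UnitaryRankOne.
Local Open Scope sesquilinear_scope.
Variables (C : numClosedFieldType) (n : nat).

Lemma ctr_mul_self_neq0 (v : 'cV[C]_n) : v != 0 -> (v ^t* *m v) 0 0 != 0.
Proof.
apply: contra_neq => h; apply/matrixP => i j; rewrite ord1 mxE.
move: h; rewrite mxE => /eqP; rewrite psumr_eq0 => [/allP|k _]; last first.
  by rewrite !mxE mulrC mul_conjC_ge0.
move=> /(_ i (mem_index_enum _)); rewrite !mxE mulrC mul_conjC_eq0.
by move=> /eqP.
Qed.

Lemma ctr_rank1_proj (v : 'cV[C]_n) :
  (rank1_proj v (v ^t*)) ^t* = rank1_proj v (v ^t*).
Proof.
rewrite /rank1_proj; set k := _^-1; have kE : k^* = k.
  rewrite /k fmorphV mxE rmorph_sum /=; congr (_ ^-1); apply: eq_bigr => i _.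
  by rewrite !mxE rmorphM /= conjCK mulrC.
apply/matrixP => i j; rewrite !mxE !big_ord1 !mxE !rmorphM /= conjCK kE.
by rewrite [_^* * _]mulrC.
Qed.

Lemma ctr_rotation l (v : 'cV[C]_n) :
  (rotation l v (v ^t*)) ^t* = rotation (l^*) v (v ^t*).
Proof.
have := ctr_rank1_proj v; rewrite /rotation; move: (rank1_proj _ _) => P PE.
rewrite -[in RHS]PE; apply/matrixP => i j.
rewrite !mxE rmorphD rmorphB rmorphM /= eq_sym; congr (_ + (_ - _)).
by rewrite conjC_nat.
Qed.

Lemma rotation_unitary l (v : 'cV[C]_n) : v != 0 ->
  (rotation l v (v ^t*) \is unitarymx) = (l * l^* == 1).
Proof.
move=> v0; have c0 := ctr_mul_self_neq0 v0.
apply/unitarymxP/eqP; rewrite ctr_rotation rotationM //; last first.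
  by move=> ->; exact: rotation1.
move=> h; have := rotation_mul_v (l * l^*) c0; rewrite h mul1mx => /esym/eqP.
rewrite -subr_eq0 -{2}[v]scale1r -scalerBl scaler_eq0 (negbTE v0) orbF subr_eq0.
by move=> /eqP.
Qed.

Lemma rotation_sub1 l (v : 'cV[C]_n) (v' : 'rV[C]_n) :
  1%:M - rotation l v v' = (1 - l) *: rank1_proj v v'.
Proof.
rewrite /rotation; move: (rank1_proj _ _) => P.
by apply/matrixP => i j; rewrite !mxE; ring.
Qed.

Lemma rank_rank1_proj (v : 'cV[C]_n) : v != 0 -> \rank (rank1_proj v (v ^t*)) = 1%N.
Proof.
move=> v0; have c0 := ctr_mul_self_neq0 v0.
apply/eqP; rewrite eqn_leq; apply/andP; split.
  rewrite /rank1_proj; apply: leq_trans (mxrank_scale _ _) _.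
  by apply: leq_trans (mxrankM_maxl _ _) _; exact: rank_leq_col.
rewrite lt0n mxrank_eq0; apply: contra_neq v0 => P0.
by have [<- _] := rank1_projP c0; rewrite P0 mul0mx.
Qed.

Lemma mxtrace_rank1_proj (v : 'cV[C]_n) (v' : 'rV[C]_n) :
  (v' *m v) 0 0 != 0 -> \tr (rank1_proj v v') = 1.
Proof.
move=> c0; rewrite /rank1_proj linearZ /= mxtrace_mulC /mxtrace big_ord1.
by rewrite mulVf.
Qed.

Lemma rank1_projZ a (v : 'cV[C]_n) : a != 0 ->
  rank1_proj (a *: v) ((a *: v) ^t*) = rank1_proj v (v ^t*).
Proof.
move=> a0; have -> : (a *: v) ^t* = a^* *: (v ^t*).
  by apply/matrixP => i j; rewrite !mxE rmorphM.
rewrite /rank1_proj -!scalemxAl -!scalemxAr !scalerA; congr (_ *: _).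
have ac0 : a^* != 0 by rewrite conjC_eq0.
move: (v ^t* *m v) => B; rewrite mxE !invfM.
by rewrite mulrC !mulrA mulfV // mul1r mulrAC mulVf // mul1r.
Qed.

Lemma rank1_mulmx (A : 'M[C]_n) : \rank A = 1%N ->
  exists (x : 'cV[C]_n) (y : 'rV[C]_n), A = x *m y.
Proof.
move=> r1; have := mulmx_base A; move: (col_base A) (row_base A).
by rewrite r1 => x y <-; exists x, y.
Qed.

(* U U^* = 1 with U = 1 - x y forces y to be a multiple of x^*. *)
Lemma unitary_rank1_rotation (U : 'M[C]_n) :
  U \is unitarymx -> \rank (1%:M - U) = 1%N ->
  exists (v : 'cV[C]_n) (l : C),
    [/\ v != 0, U = rotation l v (v ^t*), l * l^* = 1 & l != 1].
Proof.
move=> Uu r1; have [x [y Exy]] := rank1_mulmx r1.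
have UE : U = 1%:M - x *m y by rewrite -Exy opprB addrC subrK.
have xy0 : x *m y != 0 by rewrite -mxrank_eq0 -Exy r1.
have x0 : x != 0 by apply: contra_neq xy0 => ->; rewrite mul0mx.
have g0 := ctr_mul_self_neq0 x0; pose g := (x ^t* *m x) 0 0.
have [a yE] : exists a, y = a *: x ^t*.
  have ctrB (A : 'M[C]_n) : (1%:M - A) ^t* = 1%:M - A ^t*.
    by apply/matrixP => i j; rewrite !mxE rmorphB /= conjC_nat eq_sym.
  have ctrM (b : 'cV[C]_n) (c : 'rV[C]_n) : (b *m c) ^t* = c ^t* *m b ^t*.
    by rewrite trmx_mul map_mxM.
  (* Applied to [x], the equation U U^* = 1 becomes g y^* + (b - c g) x = 0, with b = y x and c = y
     y^*. *)
  move/unitarymxP: Uu; rewrite UE ctrB ctrM => /(congr1 (mulmxr x)) /=.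
  rewrite -mulmxA [(1%:M - y ^t* *m _) *m x]mulmxBl !mul1mx -[y ^t* *m _ *m x]mulmxA.
  rewrite mulmxBl mul1mx -mulmxA mulmxBr [y *m (y ^t* *m _)]mulmxA.
  rewrite (mulmx_rv_cv (x ^t*) x) (mulmx_rv_cv y x) (mulmx_rv_cv y (y ^t*)) -/g.
  rewrite -scalar_mxM -raddfB /= !mul_mx_scalar.
  move: ((y *m x) 0 0) ((y *m y ^t*) 0 0) => b c /eqP.
  rewrite -subr_eq0 addrAC [x - _ - x]addrAC subrr sub0r -opprD oppr_eq0 => /eqP.
  move=> /(congr1 (fun z => g^-1 *: z)); rewrite scaler0 scalerDr !scalerA mulVf //.
  rewrite scale1r => /eqP; rewrite addr_eq0 -scaleNr => /eqP yE.
  exists ((- (g^-1 * (b - c * g)))^*); apply/matrixP => i j.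
  have := congr1 (fun z : 'cV[C]_n => (z j i)^*) yE.
  by rewrite !mxE conjCK rmorphM.
(* The scalar 1 - a g is the eigenvalue of [U] on [x]. *)
have UR : U = rotation (1 - a * g) x (x ^t*).
  apply: (can_inj (subKr 1%:M)); rewrite rotation_sub1 Exy subKr.
  by rewrite yE /rank1_proj -scalemxAr -/g scalerA mulfK.
exists x, (1 - a * g); split => //.
  by apply/eqP; rewrite -(rotation_unitary _ x0) -UR.
apply: contra_neq xy0 => l1; rewrite -Exy UR l1 rotation1 subrr //.
Qed.

End UnitaryRankOne.

(** * The disjoint cells covering the stratum *)

Section StratumCover.
Local Open Scope sesquilinear_scope.
Variables (R : realType) (N : nat).
Local Notation C := R[i].
Local Notation dim := (2 * N.+1).-1%N.
Local Notation pvec k t := (affine_point k (chart_coord t)).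
Local Notation T d := (d.-tuple (measurableTypeR R)).

Definition angle_strip d : set 'rV[R]_d := [set t | 0 < coord t 0 < 2 * pi].

Lemma angle_strip_open d : open (@angle_strip d).
Proof.
rewrite (_ : @angle_strip d = (fun t => coord t 0) @^-1` `]0, 2 * pi[).
  apply: open_comp; last exact: interval_open.
  by move=> t _; exact: continuous_coord.
by apply/seteqP; split => t /=; rewrite in_itv.
Qed.

Lemma pvec_neq0 (k : 'I_N.+1) (t : 'rV[R]_dim) : pvec k t != 0.
Proof.
apply/eqP => /(congr1 (fun v : 'cV_N.+1 => v k 0)); rewrite !mxE eqxx.
by move/eqP; rewrite oner_eq0.
Qed.

Lemma circle_coord_neq1 d (t : 'rV[R]_d) : angle_strip t -> circle_coord t != 1.
Proof.
move=> /cos_lt1 h; apply/eqP => /(congr1 (@complex.Re R)) /= e.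
by rewrite e ltxx in h.
Qed.

Lemma phi_param_stratum (k : 'I_N.+1) (t : 'rV[R]_dim) :
  angle_strip t -> stratum (phi_param k t).
Proof.
move=> /circle_coord_neq1 l1; have v0 := pvec_neq0 k t; rewrite phi_paramE; split.
  by rewrite rotation_unitary // circle_coord_mul_conj.
rewrite mxrank_ker mxrank_tr rotation_sub1 mxrank_scale_nz; last first.
  by rewrite subr_eq0 eq_sym.
by rewrite rank_rank1_proj // subn1.
Qed.

(** The matrix 1 - phi is (1 - l) P with P of trace 1: its trace determines l, and division by 1 -
    l, nonzero on the strip, determines P. *)
Lemma phi_param_eq (k l : 'I_N.+1) (t s : 'rV[R]_dim) : angle_strip t ->
  phi_param k t = phi_param l s ->
  circle_coord t = circle_coord s /\
  rank1_proj (pvec k t) ((pvec k t) ^t*) = rank1_proj (pvec l s) ((pvec l s) ^t*).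
Proof.
move=> /circle_coord_neq1 l1 h.
have cs := ctr_mul_self_affine_point_neq0 l s.
have ct := ctr_mul_self_affine_point_neq0 k t.
have E : (1 - circle_coord t) *: rank1_proj (pvec k t) ((pvec k t) ^t*) =
    (1 - circle_coord s) *: rank1_proj (pvec l s) ((pvec l s) ^t*).
  by rewrite -(rotation_sub1 (circle_coord t)) -(rotation_sub1 (circle_coord s))
    -!phi_paramE h.
have P1 := mxtrace_rank1_proj ct; have P2 := mxtrace_rank1_proj cs.
move: (circle_coord t) (circle_coord s) (rank1_proj (pvec k t) _)
  (rank1_proj (pvec l s) _) l1 E P1 P2 => a b P Q a1 E P1 P2.
have := congr1 mxtrace E; rewrite !linearZ /= P1 P2 !mulr1 => /addrI /oppr_inj ab.
split; first exact: ab.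
have a0 : 1 - a != 0 by rewrite subr_eq0 eq_sym.
by apply: (scalerI a0); rewrite E ab.
Qed.

Lemma rank1_proj_pvec (k : 'I_N.+1) (t : 'rV[R]_dim) i :
  rank1_proj (pvec k t) ((pvec k t) ^t*) i k =
  (((pvec k t) ^t* *m pvec k t) 0 0)^-1 * pvec k t i 0.
Proof.
rewrite /rank1_proj mxE; congr (_ * _).
by rewrite mxE big_ord1 [(_ ^t*) 0 k]mxE [_^T 0 k]mxE [pvec k t k 0]mxE eqxx
  conjC1 mulr1.
Qed.

Lemma coord_ext d (t s : 'rV[R]_d) : coord t =1 coord s -> t = s.
Proof.
by move=> h; apply/matrixP => i j; rewrite ord1 -!coord_ord h.
Qed.

Lemma coord_default d (t : 'rV[R]_d) j : (d <= j)%N -> coord t j = 0.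
Proof. by rewrite /coord; case: insubP => // i jd _; rewrite leqNgt jd. Qed.

(** Column [k] of the projection is the representative of the line up to a factor, and the factor is
    read off from entry [k], where the representative is 1. *)
Lemma phi_param_inj (k : 'I_N.+1) :
  {in @angle_strip dim &, injective (@phi_param R N.+1 k)}.
Proof.
move=> t s /[!inE] tW sW /(phi_param_eq tW)[lE PE].
have c0 := ctr_mul_self_affine_point_neq0 k t.
have PEk i : (((pvec k t) ^t* *m pvec k t) 0 0)^-1 * pvec k t i 0 =
    (((pvec k s) ^t* *m pvec k s) 0 0)^-1 * pvec k s i 0.
  by rewrite -(rank1_proj_pvec k t i) -(rank1_proj_pvec k s i) PE.
have cE := PEk k.
rewrite [pvec k t k 0]mxE [pvec k s k 0]mxE eqxx !mulr1 in cE.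
have vE i : pvec k t i 0 = pvec k s i 0.
  by have := PEk i; rewrite -cE => /mulfI; apply; rewrite invr_neq0.
have zE j : (j < N)%N -> chart_coord t j = chart_coord s j.
  move=> jN; have := vE (lift k (Ordinal jN)).
  by rewrite !mxE eq_sym (negbTE (neq_lift _ _)) bumpK.
apply: coord_ext => -[|j].
  by case: lE => ec es; exact: (cos_sin_inj tW sW ec es).
have [jd|dj] := ltnP j N.*2; last first.
  have dj1 : (dim <= j.+1)%N by rewrite mul2n doubleS.
  by rewrite (coord_default t dj1) (coord_default s dj1).
have jN : (j./2 < N)%N by rewrite ltn_half_double.
have [h1 h2] : coord t j./2.*2.+1 = coord s j./2.*2.+1 /\
    coord t j./2.*2.+2 = coord s j./2.*2.+2.
  by have := zE _ jN; rewrite /chart_coord => -[].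
by rewrite -(odd_double_half j); case: (odd j); rewrite ?add1n ?add0n.
Qed.

Lemma stratum_phi_param (U : 'M[C]_N.+1) : stratum U ->
  exists (k : 'I_N.+1) (t : 'rV[R]_dim),
    [/\ angle_strip t, forall j, (0 < j <= k.*2)%N -> coord t j = 0 &
        U = phi_param k t].
Proof.
move=> [Uu]; rewrite mxrank_ker mxrank_tr => rU.
have r1 : \rank (1%:M - U) = 1%N.
  have := rank_leq_row (1%:M - U); move: rU; rewrite /= => rU rle.
  by rewrite -(subKn rle) rU subSnn.
have [v [l [v0 UE ll l1]]] := unitary_rank1_rotation Uu r1.
have /existsP/= exk : [exists i, v i 0 != 0].
  apply: contra_neqT v0 => /existsPn h; apply/matrixP => i j; rewrite ord1 mxE.
  by have := h i; rewrite negbK => /eqP.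
(* The chart is that of the first nonzero coordinate, which puts the point in the cell of [k]. *)
have [k vk kmin] : exists2 k : 'I_N.+1, v k 0 != 0 &
    forall i : 'I_N.+1, (i < k)%N -> v i 0 = 0.
  case: exk => i0 vi0; 
  have := @arg_minnP _ i0 (fun i => v i 0 != 0) (fun i => i : nat) vi0.
  case=> k vk km.
  exists k => // i ik; apply/eqP/negPn/negP => /km; by rewrite leqNgt ik.
pose w := (v k 0)^-1 *: v.
have wk : w k 0 = 1 by rewrite mxE mulVf.
have wi (i : 'I_N.+1) : (i < k)%N -> w i 0 = 0.
  by move=> ik; rewrite mxE (kmin _ ik) mulr0.
have UEw : U = rotation l w (w ^t*).
  by rewrite UE /rotation /w rank1_projZ // invr_neq0.
have [a apos [ca sa]] : exists2 a : R, 0 < a < 2 * pi &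
    cos a = complex.Re l /\ sin a = complex.Im l.
  case: l {UE UEw} ll l1 => x y ll l1; apply: exists_angle.
    have /(congr1 (@complex.Re R)) /= := ll; rewrite -[X in _ = X -> _]/(1 : R).
    by move=> <-; ring.
  by move=> /= [xE yE]; move: l1; rewrite xE yE eqxx.
pose z j : C := if insub j is Some i then w (lift k (i : 'I_N)) 0 else 0.
(* Indices 2 j + 1 and 2 j + 2 hold the real and imaginary parts of z_j, so [i.-1./2] recovers j
   from either. *)
pose t : 'rV[R]_dim := \row_i (if i == 0%N :> nat then a else
  if odd i then complex.Re (z i.-1./2) else complex.Im (z i.-1./2)).
have tE j : (j < N.*2.+1)%N -> coord t j = (if j == 0%N then a else
    if odd j then complex.Re (z j.-1./2) else complex.Im (z j.-1./2)).
  move=> jd; have jd' : (j < dim)%N by rewrite mul2n doubleS.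
  by rewrite (coord_ord t (Ordinal jd')) mxE.
have t0 : coord t 0 = a by rewrite tE.
have tz j : (j < N)%N -> chart_coord t j = z j.
  move=> jN; have h1 : (j.*2.+1 < N.*2.+1)%N by rewrite ltnS ltn_double.
  have h2 : (j.*2.+2 < N.*2.+1)%N by rewrite ltnS -doubleS leq_double.
  rewrite /chart_coord (tE _ h1) (tE _ h2) /= ?odd_double /=.
  by rewrite doubleK uphalf_double; case: (z j).
have tv : pvec k t = w.
  apply/matrixP => i j; rewrite ord1 mxE; case: (unliftP k i) => [i' ->|->].
    rewrite eq_sym (negbTE (neq_lift _ _)) /= bumpK tz // /z.
    by case: insubP => [i'' _ /val_inj -> //|]; rewrite ltn_ord.
  by rewrite eqxx wk.
exists k, t; split.
- by rewrite /angle_strip /= t0.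
- move=> [//|j] /= jk; have jN : (j < N.*2)%N.
    apply: leq_trans jk _; rewrite leq_double -ltnS; exact: ltn_ord.
  have jk2 : (j./2 < k)%N by rewrite ltn_half_double.
  rewrite tE //= /z; case: insubP => [i _ iE|_]; last by case: (odd j).
  rewrite wi; first by case: (~~ odd j).
  by rewrite /= /bump iE [(k <= _)%N]leqNgt jk2.
rewrite phi_paramE tv UEw; congr (rotation _ _ _).
by rewrite /circle_coord t0 ca sa; case: (l).
Qed.

(** The diagonal entry [k] of the projection is nonzero in the chart [k], but zero on the later
    cell, where coordinate [k] of the line vanishes. *)
Lemma phi_param_disjoint (k l : 'I_N.+1) (t s : 'rV[R]_dim) : (k < l)%N ->
  angle_strip t -> (forall j, (0 < j <= l.*2)%N -> coord s j = 0) ->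
  phi_param k t <> phi_param l s.
Proof.
move=> kl tW s0 /(phi_param_eq tW)[_ /matrixP/(_ k k)].
rewrite (rank1_proj_pvec k t k) [pvec k t k 0]mxE eqxx mulr1 => /eqP.
have vk0 : pvec l s k 0 = 0.
  rewrite mxE ifN; last by rewrite neq_ltn kl.
  have kE : unbump l k = k by rewrite /unbump ltnNge ltnW // subn0.
  have h1 : (0 < k.*2.+1 <= l.*2)%N by rewrite /= ltn_double.
  have h2 : (0 < k.*2.+2 <= l.*2)%N by rewrite /= -doubleS leq_double.
  by rewrite kE /chart_coord (s0 _ h1) (s0 _ h2).
have -> : rank1_proj (pvec l s) ((pvec l s) ^t*) k k = 0.
  by rewrite /rank1_proj [LHS]mxE [X in _ * X]mxE big_ord1 vk0 mul0r mulr0.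
by rewrite invr_eq0; apply/negP; exact: ctr_mul_self_affine_point_neq0.
Qed.

End StratumCover.

(** * Assembling the integral over the stratum *)

Section StratumIntegral.
Variables (R : realType) (N : nat).
Local Notation C := R[i].
Local Notation dim := (2 * N.+1).-1%N.
Local Notation lt := (lebesgue_tuple R).
Local Notation T d := (d.-tuple (measurableTypeR R)).

Lemma coord_row_of_tuple d (t : T d) j : coord (row_of_tuple t) j = nth 0 t j.
Proof.
have [jd|dj] := ltnP j d; last by rewrite coord_default // nth_default // size_tuple.
by rewrite (coord_ord _ (Ordinal jd)) mxE (tnth_nth 0).
Qed.

Lemma row_of_tuple_surj d (r : 'rV[R]_d) : exists t : T d, row_of_tuple t = r.
Proof.
exists [tuple r 0 i | i < d]; apply/matrixP => i j.
by rewrite mxE tnth_mktuple ord1.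
Qed.

Lemma phi_param_positive (k : 'I_N.+1) :
  positive_param (@stratum R N.+1) (@stratum_pos R N.+1)
    (@angle_strip R dim) (@phi_param R N.+1 k).
Proof.
split.
- exact: angle_strip_open.
- exact: (C1_of_C1_mderiv _ (@C1_mderiv_phi_param R _ k)).
- exact: phi_param_inj.
- by move=> _ [t tW <-]; exact: phi_param_stratum.
- move=> t tW; exists k, t, 1%:M; split => //.
    by rewrite det1 ltr01.
  move=> i; rewrite (bigD1 i) //= mxE eqxx scale1r big1 ?addr0 // => j ji.
  by rewrite mxE eq_sym (negbTE ji) scale0r.
Qed.

Lemma pullback_phi_param (k : 'I_N.+1) (t : T dim) :
  pullback (@phi_param R N.+1 k) (@c_form R N.+1) t =
  ((pullback_constant R N * chart_density N t)%:C)%C.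
Proof.
rewrite /pullback c_form_phi_param /chart_density coord_row_of_tuple.
by under eq_bigr do rewrite coord_row_of_tuple.
Qed.

Lemma dimE : dim = N.*2.+1.
Proof. by rewrite mul2n doubleS. Qed.

Lemma pullback_constant_integral :
  (\int[lt dim]_(t in chart_cell 0)
     (pullback_constant R N * chart_density N t)%:E = 1)%E.
Proof.
under eq_integral do rewrite EFinM.
rewrite ge0_integralZl //; last 4 first.
- exact: measurable_chart_cell.
- apply/measurable_EFinP; apply: measurable_funTS.
  exact: measurable_chart_density.
- by move=> t _; rewrite lee_fin chart_density_ge0.
- rewrite lee_fin divr_ge0 // mulr_ge0 ?exprn_ge0 //.
  by rewrite mulr_ge0 // pi_ge0.
rewrite (integral_chart_density R dimE) -EFinM; congr EFin.
rewrite /pullback_constant exprMn !exprS.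
have f0 : N`!%:R != 0 :> R by rewrite pnatr_eq0 -lt0n fact_gt0.
have g0 : (N.*2)`!%:R != 0 :> R by rewrite pnatr_eq0 -lt0n fact_gt0.
have p0 : pi != 0 :> R by rewrite gt_eqF // pi_gt0.
have pN0 : pi ^+ N != 0 :> R by rewrite expf_neq0.
have tN0 : 2 ^+ N != 0 :> R by rewrite expf_neq0.
move: (N`!%:R) ((N.*2)`!%:R) (pi ^+ N) (2 ^+ N) f0 g0 pN0 tN0 =>
  f g z q f0 g0 z0 q0.
move: (@pi R) p0 => y y0.
by field; rewrite f0 g0 z0 y0.
Qed.

Lemma chart_cellS k l : (k <= l)%N -> @chart_cell R dim l `<=` chart_cell k.
Proof.
move=> kl t [h0 h]; split => // j /andP[j0 jk]; apply: h.
by rewrite j0 (leq_trans jk).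
Qed.

(** As sets of coordinates the cells are nested, and on the largest one the nonnegative density has
    integral 1. *)
Lemma integrable_pullback k : (lt dim).-integrable (chart_cell k)
  (fun t => (pullback_constant R N * chart_density N t)%:E).
Proof.
have m0 := @measurable_chart_cell R dim 0.
have mk := @measurable_chart_cell R dim k.
apply: (integrableS m0 mk (chart_cellS (leq0n k))).
apply/integrableP; split.
  apply/measurable_EFinP; apply: measurable_funTS; apply: measurable_funM => //.
  exact: measurable_chart_density.
under eq_integral => t _.
  rewrite gee0_abs; last first.
    rewrite lee_fin mulr_ge0 ?chart_density_ge0 //.
    by rewrite divr_ge0 // mulr_ge0 ?exprn_ge0 // mulr_ge0 // pi_ge0.
  over.
by rewrite pullback_constant_integral ltry.
Qed.

Lemma stratum_has_form_integral :
  has_form_integral (@stratum R N.+1) (@stratum_pos R N.+1) (@c_form R N.+1) (1 : C).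
Proof.
exists N.+1, (fun=> @angle_strip R dim), (@phi_param R N.+1),
  (fun k => @chart_cell R dim k.*2) => piece.
have cellW (k : 'I_N.+1) t : @chart_cell R dim k.*2 t ->
    angle_strip (row_of_tuple t) /\
    forall j, (0 < j <= k.*2)%N -> coord (row_of_tuple t) j = 0.
  move=> [h0 h]; split; first by rewrite /angle_strip /= coord_row_of_tuple.
  by move=> j jk; rewrite coord_row_of_tuple h.
have ReE k (t : T dim) :
    complex.Re (pullback (@phi_param R N.+1 k) (@c_form R N.+1) t) =
    pullback_constant R N * chart_density N t by rewrite pullback_phi_param.
have ImE k (t : T dim) :
    complex.Im (pullback (@phi_param R N.+1 k) (@c_form R N.+1) t) = 0.
  by rewrite pullback_phi_param.
split.
- exact: phi_param_positive.
- move=> k; split; first exact: measurable_chart_cell.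
  by move=> _ [t tA <-]; have [] := cellW k t tA.
- split.
    apply/seteqP; split => U.
      move=> [k _ [_ [t tA <-] <-]]; apply: phi_param_stratum.
      by have [] := cellW k t tA.
    move=> /stratum_phi_param[k [r [rW r0 ->]]]; exists k => //.
    have [t tE] := row_of_tuple_surj r; exists r => //; exists t => //.
    split; first by rewrite -coord_row_of_tuple tE.
    by move=> j jk; rewrite -coord_row_of_tuple tE r0.
  move=> k l _ _ [U [[_ [t tA <-] tU] [_ [s sA <-] sU]]].
  have [tW t0] := cellW k t tA; have [sW s0] := cellW l s sA.
  apply/eqP/negPn/negP; rewrite neq_ltn => /orP[kl|lk].
    by apply: (phi_param_disjoint kl tW s0); rewrite tU sU.
  by apply: (phi_param_disjoint lk sW t0); rewrite tU sU.
- move=> k; split.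
    under eq_fun do rewrite ReE; exact: integrable_pullback.
  under eq_fun do rewrite ImE; exact: integrable0.
have Im0 (k : 'I_N.+1) : \int[lt dim]_(t in chart_cell k.*2)
    complex.Im (pullback (@phi_param R N.+1 k) (@c_form R N.+1) t) = 0.
  by rewrite /Rintegral integral0_eq // => t _; rewrite ImE.
rewrite big_ord_recl big1 ?addr0 => [|k _].
  rewrite Im0; congr Complex; rewrite /Rintegral.
  under eq_integral do rewrite ReE.
  by rewrite pullback_constant_integral.
rewrite Im0; congr Complex; rewrite /Rintegral.
under eq_integral do rewrite ReE.
rewrite null_set_integral //; first exact: measurable_chart_cell.
  exact: measurable_int (integrable_pullback _).
(* Here [k : 'I_N] stands for the chart k + 1, so [N] is positive and the dimension exceeds 1. *)
apply: chart_cell_null => //.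
by rewrite dimE ltnS double_gt0 (leq_ltn_trans _ (ltn_ord k)).
Qed.

End StratumIntegral.

Theorem propositionB1 (R : realType) (n : nat) (hn : (1 <= n)%N) :
  has_form_integral (@stratum R n) (@stratum_pos R n) (@c_form R n) (1 : R[i]).
Proof. by case: n hn => // N _; exact: stratum_has_form_integral. Qed.
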